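(* Let $a>0$, $g\in\mathbb R$, and consider the integrable Hamiltonian system on $M^4_{a,g}$ with Hamiltonian $$H=\frac12\Bigl(S_1^2+S_2^2+\frac{S_3^2}\beta\Bigr)+g_1(\mathbf R^2,R_3)(S_1R_2-S_2R_1)+g_2(\mathbf R^2,R_3)\langle\mathbf S,\mathbf R\rangle+g_3(\mathbf R^2,R_3)S_3+V(\mathbf R^2,R_3)$$ and integral $K=S_3$. Any isoenergy surface $Q^3$ of this system is either $\mathbb{RP}^3$ or a disjoint union of $k$ products $S^1\times S^2$ and not more than two spheres $S^3$.
   Context: On $\mathrm e(3)^*=\mathbb R^6$ with linear coordinates $(\mathbf S,\mathbf R)=(S_1,S_2,S_3,R_1,R_2,R_3)$ consider the Lie–Poisson bracket $\{S_i,S_j\}=\varepsilon_{ijk}S_k$, $\{S_i,R_j\}=\varepsilon_{ijk}R_k$, $\{R_i,R_j\}=0$. For $a>0$, $M^4_{a,g}=\{\langle\mathbf R,\mathbf R\rangle=a,\ \langle\mathbf S,\mathbf R\rangle=g\}$ is a symplectic leaf; $\mathbf R^2=\langle\mathbf R,\mathbf R\rangle$. In the Hamiltonian, $\beta>0$ is a constant and $g_1,g_2,g_3,V$ are smooth functions of two variables (the values of $\mathbf R^2$ and $R_3$) in the range $\mathbf R^2>0$. An isoenergy surface is a (non-empty) non-singular level surface $Q^3=\{H=h\}\subset M^4_{a,g}$, i.e. the differential of $H|_{M^4_{a,g}}$ does not vanish on $Q^3$. Here $k\ge0$ is an integer, and the identification is up to diffeomorphism. *)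

(* Defs.v *)
(* MathComp / MathComp-Analysis. *)
From HB Require Import structures.
From mathcomp Require Import all_boot all_order all_algebra.
From mathcomp Require Import all_classical all_reals all_analysis.
Set Implicit Arguments.
Unset Strict Implicit.
Unset Printing Implicit Defensive.
Import Order.TTheory GRing.Theory Num.Theory numFieldNormedType.Exports.
Local Open Scope classical_set_scope.
Local Open Scope ring_scope.

(* Only finite-dimensional V and W are used below; there, [smooth_on_open] is
   C^oo in the usual sense: all iterated directional derivatives exist and are
   (Frechet) differentiable, hence continuous, at every point of U. *)
Definition iter_derive (R : realType) (V W : normedModType R)
    (f : V -> W) (vs : seq V) : V -> W :=
  foldr (fun v (h : V -> W) => 'D_v h) f vs.

Definition smooth_on_open (R : realType) (V W : normedModType R)
    (U : set V) (f : V -> W) : Prop :=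
  open U /\ forall (vs : seq V) (x : V), U x -> differentiable (iter_derive f vs) x.

(* Smoothness on an arbitrary subset A of a Euclidean space: near each of its
   points, f coincides on A with a smooth map defined on an open set. On an
   embedded submanifold this is smoothness for the induced structure. *)
Definition smooth_on (R : realType) (V W : normedModType R)
    (A : set V) (f : V -> W) : Prop :=
  forall x, A x -> exists (U : set V) (F : V -> W),
    [/\ U x, smooth_on_open U F & forall y, U y -> A y -> F y = f y].

Definition diffeomorphic (R : realType) (V W : normedModType R)
    (A : set V) (B : set W) : Prop :=
  exists (f : V -> W) (g : W -> V),
    [/\ set_fun A B f, set_fun B A g,
        (forall x, A x -> g (f x) = x) /\ (forall y, B y -> f (g y) = y),
        smooth_on A f & smooth_on B g].

(* The library norm on row vectors is the sup norm, so the Euclidean structure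
   is expressed through [dot]. *)
Definition dot (R : realType) (n : nat) (u v : 'rV[R]_n) : R :=
  \sum_(i < n) u 0 i * v 0 i.

Definition sphere (R : realType) (n : nat) : set 'rV[R]_n.+1 :=
  [set x | dot x x = 1].

Definition S1xS2 (R : realType) : set ('rV[R]_2 * 'rV[R]_3) :=
  @sphere R 1 `*` @sphere R 2.

(* The line spanned by a unit vector v of R^4 is identified with the orthogonal
   projector v^T v onto it; since v^T v = w^T w iff w = v or w = - v, this
   embeds S^3/{+1,-1} in the space of 4 x 4 matrices. *)
Definition RP3 (R : realType) : set 'M[R]_4 :=
  (fun v : 'rV[R]_4 => v^T *m v) @` @sphere R 3.

(* Q is the disjoint union of k copies of S^1 x S^2 and l copies of S^3, the
   pieces being open in Q. *)
Definition disjoint_union_S1xS2_S3 (R : realType) (V : normedModType R)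
    (k l : nat) (Q : set V) : Prop :=
  exists P : 'I_k + 'I_l -> set V,
    [/\ Q = \bigcup_i P i, trivIset setT P,
        forall i, exists2 U : set V, open U & P i = Q `&` U,
        forall i : 'I_k, diffeomorphic (P (inl i)) (@S1xS2 R)
      & forall j : 'I_l, diffeomorphic (P (inr j)) (@sphere R 3)].

(* A point x of e(3)^* is the pair (S, R) = (x.1, x.2); the coordinates
   S_1, S_2, S_3 are x.1 0 0, x.1 0 1, x.1 0 2, and likewise for R. *)
Notation e3dual R := ('rV[R]_3 * 'rV[R]_3)%type.

Definition casimir1 (R : realType) (x : e3dual R) : R := dot x.2 x.2.

Definition casimir2 (R : realType) (x : e3dual R) : R := dot x.1 x.2.

Definition leaf (R : realType) (a g : R) : set (e3dual R) :=
  [set x | casimir1 x = a /\ casimir2 x = g].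

(* The casimirs have independent differentials wherever R <> 0, so the tangent
   space of their common level through x is the common kernel. *)
Definition leaf_tangent (R : realType) (x : e3dual R) : set (e3dual R) :=
  [set v | 'd (@casimir1 R) x v = 0 /\ 'd (@casimir2 R) x v = 0].

(* The values taken by (R^2, R_3) when R ranges over R <> 0. *)
Definition coef_domain (R : realType) : set (R * R) :=
  [set p | 0 < p.1 /\ p.2 ^+ 2 <= p.1].

Definition hamiltonian (R : realType) (beta : R) (g1 g2 g3 V : R * R -> R)
    (x : e3dual R) : R :=
  let S := x.1 in
  let r := x.2 in
  let p := (dot r r, r 0 2) in
  2^-1 * (S 0 0 ^+ 2 + S 0 1 ^+ 2 + S 0 2 ^+ 2 / beta)
  + g1 p * (S 0 0 * r 0 1 - S 0 1 * r 0 0)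
  + g2 p * dot S r
  + g3 p * S 0 2
  + V p.

Definition level (R : realType) (a g : R) (H : e3dual R -> R) (h : R) :
  set (e3dual R) := leaf a g `&` [set x | H x = h].

Definition isoenergy_surface (R : realType) (a g : R) (H : e3dual R -> R)
    (Q : set (e3dual R)) : Prop :=
  exists h : R,
    [/\ Q = level a g H h, Q !=set0
      & forall x, Q x -> exists2 v, leaf_tangent x v & 'd H x v != 0].

(* Main.v *)
(* Completing squares turns the fiber of Q over a point R of the sphere R^2 = a
   into the set of vectors of a plane whose squared length is a function of R_3
   alone, so Q is diffeomorphic to the set of pairs (tau, r) with |r| = 1,
   <tau, r> = 0 and |tau|^2 = f(r_3). Regularity of the level means that f does not
   vanish at 1 and -1 and that its zeros are simple, hence finitely many. If f > 0
   everywhere, Q is the unit tangent bundle of S^2, that is SO(3) = RP^3.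
   Otherwise each maximal interval where f > 0 gives one component: S^1 x S^2
   when both ends are zeros of f, S^3 when one end is a pole. Dividing f by its
   zeros (Hadamard's lemma) makes these diffeomorphisms explicit. *)

(* Two obstacles shape the proof. Smoothness on a set means only that local smooth extensions exist,
   and [f] is controlled just on the closed interval [-1, 1], where a derivative at an endpoint
   would depend on arbitrary outside values. Division by a zero is therefore performed at interior
   points alone. Regularity permits this: over a zero of [f] the quadratic part of [H] has zero
   differential, so [H] varies along the leaf only through the change of [R_3], while at a pole of
   the sphere a tangent vector of the leaf leaves [R_3] stationary. The second obstacle is [beta].
   Completing squares rescales [S_3] by [1 / sqrt beta], so the plane containing the fiber is
   orthogonal not to [R] but to [(R_1, R_2, sqrt beta * R_3)], which runs over an ellipsoid.
   Normalising that vector replaces [R_3] by another height, and [f] is a function of this new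
   height. The bound two on the number of spheres S^3 holds because each of them uses up a pole. *)
Require Import Defs.
From HB Require Import structures.
From mathcomp Require Import all_boot all_order all_algebra.
From mathcomp Require Import all_classical all_reals all_analysis.
From mathcomp Require Import ring lra.
Set Implicit Arguments.
Unset Strict Implicit.
Unset Printing Implicit Defensive.
Import Order.TTheory GRing.Theory Num.Theory numFieldNormedType.Exports.
Local Open Scope classical_set_scope.
Local Open Scope ring_scope.

(** * Differentiability of finite order and its closure rules *)

Section Ck.
Context {R : realType}.

(** The difference [g - f] vanishes near [x], so its differential there is 0, and [g] is the sum of
    [f] and this difference. *)
Lemma near_eq_differentiable (V W : normedModType R) (f g : V -> W) (x : V) :
  {near x, f =1 g} -> differentiable f x -> differentiable g x.
Proof.
move=> fg df.
have hz : \forall y \near x, (g - f) y = 0.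
  by apply: filterS fg => y; rewrite !fctE /= => ->; rewrite subrr.
suff dh : differentiable (g - f) x.
  by rewrite -[g](subrK f); apply: differentiableD.
have h0 : (g - f) x = 0 by exact: nbhs_singleton hz.
have e0 : (g - f) \o shift x = cst ((g - f) x) + \0 +o_ (0 : V) id.
  apply/eqaddoP => e e0; rewrite near_simpl /=.
  have : \forall y \near (0:V), (g - f) (y + x) = 0.
    by move: hz; rewrite (near_shift 0) /= ; apply: filterS => y; rewrite subr0 /=.
  apply: filterS => y yx; rewrite !fctE /= in yx h0 *.
  by rewrite yx h0 !addr0 subrr normr0 mulr_ge0 // ltW.
have [c0 _] := @dcst _ V W 0 x.
by apply/diff_locallyP; rewrite (diff_unique c0 e0).
Qed.

(** The recursion peels the derivative applied first to [f], so that the Leibniz and chain rules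
    feed the induction hypothesis; in the lists of [iter_derive] this direction stands last.
    Derivatives of order up to [n] are required to be differentiable, so those of order [n + 1]
    still exist. *)
Fixpoint Ck (n : nat) (V W : normedModType R) (U : set V) (f : V -> W) : Prop :=
  (forall x, U x -> differentiable f x) /\
  (if n is m.+1 then forall v, Ck m U ('D_v f) else True).

Lemma Ck_differentiable n (V W : normedModType R) (U : set V) (f : V -> W) x :
  Ck n U f -> U x -> differentiable f x.
Proof. by case: n => [|n] [+ _]; apply. Qed.

Lemma CkS n (V W : normedModType R) (U : set V) (f : V -> W) :
  Ck n.+1 U f -> Ck n U f.
Proof.
elim: n f => [|n IH] f [df Df]; split => // v.
exact: IH (Df v).
Qed.

Lemma smooth_on_openP (V W : normedModType R) (U : set V) (f : V -> W) :
  open U -> smooth_on_open U f <-> forall n, Ck n U f.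
Proof.
move=> oU; split=> [[_ +] n|H].
  elim: n f => [|n IH] f H; split=> //; try exact: (H [::]).
  by move=> v; apply: IH => vs x Ux; have := H (rcons vs v) x Ux; rewrite /iter_derive foldr_rcons.
split=> // vs; elim/last_ind: vs f H => [|vs v IH] f H x Ux.
  exact: (H 0%N).1.
rewrite /iter_derive foldr_rcons; apply: IH => // n.
by have [_] := H n.+1; apply.
Qed.

(** Formulas for derivatives hold only at points of [U]. As [U] is open, agreement on [U] is
    agreement near each of its points, hence passes to all derivatives; the closure rules below
    rewrite derivatives in this way. *)
Lemma Ck_eq n (V W : normedModType R) (U : set V) (f g : V -> W) :
  open U -> (forall x, U x -> f x = g x) -> Ck n U f -> Ck n U g.
Proof.
move=> oU; elim: n f g => [|n IH] f g fg.
  move=> [df _]; split=> // x Ux; apply: near_eq_differentiable (df _ Ux).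
  by near do apply: fg; apply: open_nbhs_nbhs.
move=> [df Df]; split=> [x Ux|v].
  apply: near_eq_differentiable (df _ Ux).
  by near do apply: fg; apply: open_nbhs_nbhs.
apply: IH (Df v) => x Ux; apply: near_eq_derive.
by near do apply: fg; apply: open_nbhs_nbhs.
Unshelve. all: by end_near. Qed.

Lemma Ck_cst n (V W : normedModType R) (U : set V) (w : W) :
  open U -> Ck n U (fun _ : V => w).
Proof.
move=> oU; elim: n w => [|n IH] w; split=> //;
  try by move=> x _; exact: differentiable_cst.
move=> v; by apply: (Ck_eq oU _ (IH 0)) => x _; rewrite derive_cst.
Qed.

Lemma CkD n (V W : normedModType R) (U : set V) (f g : V -> W) :
  open U -> Ck n U f -> Ck n U g -> Ck n U (fun x => f x + g x).
Proof.
move=> oU; elim: n f g => [|n IH] f g [df Df] [dg Dg]; split=> //;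
  try by move=> x Ux; apply: (@differentiableD _ _ _ f g); [apply: df|apply: dg].
move=> v.
apply: (Ck_eq oU _ (IH _ _ (Df v) (Dg v))) => x Ux /=.
by rewrite (@deriveD _ _ _ f g) //; apply: diff_derivable; [apply: df|apply: dg].
Qed.

Lemma Ck_sum n (V W : normedModType R) (U : set V) (I : Type) (s : seq I)
    (f : I -> V -> W) :
  open U -> (forall i, Ck n U (f i)) -> Ck n U (fun x => \sum_(i <- s) f i x).
Proof.
move=> oU fC; elim: s => [|i s IH].
  by apply: (Ck_eq oU _ (Ck_cst n 0 oU)) => x _; rewrite big_nil.
by apply: (Ck_eq oU _ (CkD oU (fC i) IH)) => x _; rewrite big_cons.
Qed.

Lemma Ck_lin n (V W Z : normedModType R) (U : set V) (f : V -> W)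
    (c : {linear W -> Z}) :
  open U -> continuous c -> Ck n U f -> Ck n U (fun x => c (f x)).
Proof.
move=> oU cc.
have dc x : U x -> differentiable f x -> differentiable (c \o f) x.
  by move=> Ux df; apply: differentiable_comp => //; apply: linear_differentiable.
elim: n f dc => [|n IH] f dc [df Df]; split=> //;
  try by move=> x Ux; apply: dc => //; apply: df.
move=> v.
have Ec : forall x, U x -> c ('D_v f x) = 'D_v (c \o f) x.
  move=> x Ux; have dfx := df x Ux.
  have dcx : differentiable c (f x) by exact: linear_differentiable.
  rewrite [RHS](@deriveE _ _ _ (c \o f)); last exact: dc.
  by rewrite (diff_comp dfx dcx) (diff_lin _ cc) (deriveE _ dfx).
apply: (Ck_eq oU Ec); apply: IH; last exact: Df.
move=> x Ux dx; by apply: differentiable_comp => //; apply: linear_differentiable.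
Qed.

Lemma CkM n (V : normedModType R) (U : set V) (f g : V -> R) :
  open U -> Ck n U f -> Ck n U g -> Ck n U (fun x => f x * g x).
Proof.
move=> oU; elim: n f g => [|n IH] f g /[dup] Cf [df Df] /[dup] Cg [dg Dg];
  split=> //;
  try by move=> x Ux; apply: (@differentiableM _ _ f g); [apply: df|apply: dg].
move=> v.
apply: (Ck_eq oU _ (CkD oU (IH _ _ (CkS Cf) (Dg v)) (IH _ _ (CkS Cg) (Df v)))).
move=> x Ux /=.
by rewrite (@deriveM _ _ f g) //; apply: diff_derivable; [apply: df|apply: dg].
Qed.

(** A bootstrap: the derivative of [1 / f] is a product of [1 / f], itself and a derivative of [f],
    so order [n] for the inverse gives order [n + 1]. The square root below is treated alike. *)
Lemma CkV n (V : normedModType R) (U : set V) (f : V -> R) :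
  open U -> (forall x, U x -> f x != 0) -> Ck n U f -> Ck n U (fun x => (f x)^-1).
Proof.
move=> oU f0; elim: n => [|n IH] /[dup] Cf [df Df]; split=> //;
  try by move=> x Ux; apply: (@differentiableV _ _ f); [apply: df|apply: f0].
move=> v.
have CV := IH (CkS Cf).
have := CkM oU (CkM oU (CkM oU CV CV) (Df v)) (Ck_cst n (-1 : R) oU).
apply: Ck_eq => // x Ux /=.
rewrite (@deriveV _ _ f) ?f0 //; last by apply: diff_derivable; apply: df.
by rewrite /GRing.scale /= expr2 mulrN1 invfM mulNr.
Qed.

Lemma Ck_sqrt n (V : normedModType R) (U : set V) (f : V -> R) :
  open U -> (forall x, U x -> 0 < f x) -> Ck n U f ->
  Ck n U (fun x => Num.sqrt (f x)).
Proof.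
move=> oU f0.
have dsq x : U x -> is_derive (f x) 1 Num.sqrt (2 * Num.sqrt (f x))^-1.
  by move=> Ux; apply: is_derive1_sqrt; apply: f0.
have ds x : U x -> differentiable Num.sqrt (f x).
  by move=> Ux; apply/derivable1_diffP; have [] := dsq x Ux.
elim: n => [|n IH] /[dup] Cf [df Df]; split=> //;
  try by move=> x Ux; apply: (@differentiable_comp _ _ _ _ f Num.sqrt); [apply: df|apply: ds].
move=> v.
have s0 x : U x -> 2 * Num.sqrt (f x) != 0.
  by move=> Ux; rewrite mulf_neq0 // gt_eqF // sqrtr_gt0 f0.
have C2 := CkM oU (Ck_cst n (2 : R) oU) (IH (CkS Cf)).
have := CkM oU (Df v) (CkV oU s0 C2).
apply: Ck_eq => // x Ux /=.
rewrite [RHS](@deriveE _ _ _ (Num.sqrt \o f)); last first.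
  by apply: (@differentiable_comp _ _ _ _ f Num.sqrt); [apply: df|apply: ds].
rewrite (diff_comp (df x Ux) (ds x Ux)) /=.
rewrite -(deriveE _ (df x Ux)).
rewrite -[X in 'd Num.sqrt _ X]mulr1 -[RHS]/('d Num.sqrt (f x) ('D_v f x *: 1)).
rewrite linearZ -(deriveE _ (ds x Ux)).
by have [_ ->] := dsq x Ux.
Qed.

(** Continuous coordinates with respect to a finite spanning family: the form of finite dimension
    that the chain rule uses. *)
Definition frame (W : normedModType R) (I : finType) (e : I -> W)
    (c : I -> {linear W -> R}) : Prop :=
  (forall i, continuous (c i)) /\ forall w, w = \sum_i c i w *: e i.

Lemma Ck_frame n (V W : normedModType R) (I : finType) (e : I -> W) c
    (U : set V) (f : V -> W) :
  frame e c -> open U -> (forall i, Ck n U (fun x => c i (f x))) -> Ck n U f.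
Proof.
move=> [cc E] oU cf.
have H i : Ck n U (fun x => c i (f x) *: e i).
  have sx_lin : linear ( *:%R ^~ (e i) : R -> W).
    by move=> u y z; rewrite scalerDl scalerA.
  pose sxlM := GRing.isLinear.Build _ _ _ _ _ sx_lin.
  pose sxL : {linear R -> W} := HB.pack ( *:%R ^~ (e i)) sxlM.
  by apply: (@Ck_lin n _ _ _ U _ sxL) => //; exact/scalel_continuous.
apply: (Ck_eq oU _ (Ck_sum (index_enum I) oU H)) => x _.
by rewrite [RHS]E.
Qed.

(** The derivative of [g \o f] along [v] is that of [g] in the direction ['D_v f x], which moves
    with [x]. The frame resolves it into the fixed directions [e i], and the sum of products so
    obtained falls under the induction hypothesis. *)
Lemma Ck_comp_scalar n (V W : normedModType R) (I : finType) (e : I -> W) c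
    (U : set V) (O : set W) (f : V -> W) (g : W -> R) :
  frame e c -> open U -> open O -> (forall x, U x -> O (f x)) ->
  Ck n U f -> Ck n O g -> Ck n U (fun x => g (f x)).
Proof.
move=> fr oU oO UO; elim: n g => [|n IH] g /[dup] Cf [df Df] [dg Dg];
  split=> //;
  try by move=> x Ux; apply: (@differentiable_comp _ _ _ _ f g); [apply: df|apply: dg; apply: UO].
move=> v.
have H i : Ck n U (fun x => c i ('D_v f x) * 'D_(e i) g (f x)).
  apply: CkM => //; last by apply: (IH ('D_(e i) g) (CkS Cf) (Dg _)).
  by apply: Ck_lin; [exact: oU|exact: fr.1|exact: Df].
apply: (Ck_eq oU _ (Ck_sum (index_enum I) oU H)) => x Ux.
have dgf := dg _ (UO _ Ux).
rewrite [RHS](@deriveE _ _ _ (g \o f)); last first.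
  by apply: (@differentiable_comp _ _ _ _ f g) => //; apply: df.
rewrite (diff_comp (df x Ux) dgf) /= -(deriveE _ (df x Ux)).
rewrite [in RHS](fr.2 ('D_v f x)) linear_sum; apply: eq_bigr => i _.
by rewrite linearZ (deriveE _ dgf).
Qed.

Lemma Ck_comp n (V W Z : normedModType R) (I : finType) (e : I -> W) c
    (J : finType) (e' : J -> Z) c'
    (U : set V) (O : set W) (f : V -> W) (g : W -> Z) :
  frame e c -> frame e' c' -> open U -> open O -> (forall x, U x -> O (f x)) ->
  Ck n U f -> Ck n O g -> Ck n U (fun x => g (f x)).
Proof.
move=> fr fr' oU oO UO Cf Cg; apply: (Ck_frame fr') => // j.
apply: (@Ck_comp_scalar n _ _ _ _ _ U O f (fun y => c' j (g y))) => //; try exact: fr.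
by apply: Ck_lin => //; exact: fr'.1.
Qed.

End Ck.

(** * Frames of matrix and product spaces, supplied by class inference *)

Class framed (R : realType) (W : normedModType R) : Prop :=
  ex_frame : exists (I : finType) (e : I -> W) (c : I -> {linear W -> R}),
    frame e c.

Section Frames.
Context {R : realType}.

Global Instance framed_mx m n : framed ('M[R]_(m, n) : normedModType R).
Proof.
have @c : 'I_m * 'I_n -> {linear 'M[R]_(m, n) -> R}.
  by move=> p; exists (fun N : 'M[R]_(_, _) => N p.1 p.2); do 2![eexists]; do ?[constructor];
     rewrite ?mxE// => ? *; rewrite ?mxE//; move=> ?; rewrite !mxE.
exists ('I_m * 'I_n)%type, (fun p => delta_mx p.1 p.2), c; split=> [p|w].
  exact: coord_continuous.
rewrite {1}[w]matrix_sum_delta pair_big /=.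
by apply: eq_bigr.
Qed.

Global Instance framed_real : framed (R : normedModType R).
Proof.
exists 'I_1, (fun _ => 1), (fun _ => idfun); split=> [i|w].
  by move=> x; exact: cvg_id.
by rewrite big_ord1 /= /GRing.scale /= mulr1.
Qed.

Definition pairl (V W : normedModType R) (v : V) : V * W := (v, 0).
Definition pairr (V W : normedModType R) (w : W) : V * W := (0, w).

Lemma pairl_linear (V W : normedModType R) : linear (@pairl V W).
Proof. by move=> a u v; congr pair; rewrite /= scaler0 addr0. Qed.

Lemma pairr_linear (V W : normedModType R) : linear (@pairr V W).
Proof. by move=> a u v; congr pair; rewrite /= scaler0 addr0. Qed.

HB.instance Definition _ (V W : normedModType R) :=
  GRing.isLinear.Build _ _ _ _ (@pairl V W) (@pairl_linear V W).
HB.instance Definition _ (V W : normedModType R) :=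
  GRing.isLinear.Build _ _ _ _ (@pairr V W) (@pairr_linear V W).

Lemma pairl_continuous (V W : normedModType R) : continuous (@pairl V W).
Proof. by move=> v; apply: cvg_pair => /=; [exact: cvg_id|exact: cvg_cst]. Qed.

Lemma pairr_continuous (V W : normedModType R) : continuous (@pairr V W).
Proof. by move=> v; apply: cvg_pair => /=; [exact: cvg_cst|exact: cvg_id]. Qed.

Lemma fst_continuous (V W : normedModType R) : continuous (@fst V W).
Proof. by move=> v; exact: cvg_fst. Qed.

Lemma snd_continuous (V W : normedModType R) : continuous (@snd V W).
Proof. by move=> v; exact: cvg_snd. Qed.

Global Instance framed_pair (V W : normedModType R) :
  framed V -> framed W -> framed (V * W : normedModType R)%type.
Proof.
move=> [I [e [c [cc E]]]] [J [e' [c' [cc' E']]]].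
pose C (i : I + J) : {linear (V * W)%type -> R} := match i with
  | inl i => c i \o fst | inr j => c' j \o snd end.
exists (I + J)%type, (fun i => match i with inl i => (e i, 0) | inr j => (0, e' j) end), C.
split=> [[i|j]|[v w]].
- by move=> x; apply: continuous_comp; [exact: fst_continuous|exact: cc].
- by move=> x; apply: continuous_comp; [exact: snd_continuous|exact: cc'].
rewrite big_sumType /=.
have -> : \sum_i c i v *: ((e i, 0) : V * W) = (v, 0).
  rewrite {2}[v]E -/(pairl W _) linear_sum.
  by apply: eq_bigr => i _; rewrite linearZ.
have -> : \sum_i c' i w *: ((0, e' i) : V * W) = (0, w).
  rewrite {2}[w]E' -/(pairr V _) linear_sum.
  by apply: eq_bigr => i _; rewrite linearZ.
by congr pair; rewrite /= ?addr0 ?add0r.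
Qed.

End Frames.

(** * Closure rules for smoothness on arbitrary subsets *)

Section SmoothOn.
Context {R : realType}.

Lemma Ck_sub n (V W : normedModType R) (U U' : set V) (f : V -> W) :
  U' `<=` U -> Ck n U f -> Ck n U' f.
Proof.
move=> sU; elim: n f => [|n IH] f [df Df]; split=> //.
- by move=> x /sU; exact: df.
- by move=> x /sU; exact: df.
- by move=> v; apply: IH (Df v).
Qed.

Lemma Ck_preimage_open n (V W : normedModType R) (U : set V) (O : set W)
    (f : V -> W) : open U -> open O -> Ck n U f -> open (U `&` f @^-1` O).
Proof.
move=> oU oO Cf; rewrite openE => x [Ux Ox].
have cf : {for x, continuous f}.
  by apply: differentiable_continuous; exact: Ck_differentiable Cf Ux.
by apply: filterI; [exact: open_nbhs_nbhs|apply: cf; exact: open_nbhs_nbhs].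
Qed.

Lemma smooth_on_intro (V W : normedModType R) (A : set V) (f : V -> W) :
  (forall x, A x -> exists (U : set V) (F : V -> W), [/\ U x, open U,
     (forall n, Ck n U F) & forall y, U y -> A y -> F y = f y]) ->
  smooth_on A f.
Proof.
move=> H x Ax; have [U [F [Ux oU CF EF]]] := H x Ax.
by exists U, F; split=> //; apply/smooth_on_openP.
Qed.

Lemma smooth_on_elim (V W : normedModType R) (A : set V) (f : V -> W) x :
  smooth_on A f -> A x -> exists (U : set V) (F : V -> W), [/\ U x, open U,
     (forall n, Ck n U F) & forall y, U y -> A y -> F y = f y].
Proof.
move=> H Ax; have [U [F [Ux sF EF]]] := H x Ax.
have oU := sF.1; exists U, F; split=> //.
exact/smooth_on_openP.
Qed.

Lemma smooth_on_subset (V W : normedModType R) (A B : set V) (f : V -> W) :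
  A `<=` B -> smooth_on B f -> smooth_on A f.
Proof.
move=> AB H x /AB /H [U [F [Ux sF EF]]]; exists U, F; split=> // y Uy /AB.
exact: EF.
Qed.

Lemma smooth_on_ext (V W : normedModType R) (A : set V) (f g : V -> W) :
  (forall x, A x -> f x = g x) -> smooth_on A f -> smooth_on A g.
Proof.
move=> fg H x /[dup] Ax /H [U [F [Ux sF EF]]]; exists U, F; split=> // y Uy Ay.
by rewrite -fg // EF.
Qed.

Lemma smooth_on_cst (V W : normedModType R) (A : set V) (w : W) :
  smooth_on A (fun _ : V => w).
Proof.
apply: smooth_on_intro => x _; exists setT, (fun _ => w); split=> //.
  exact: openT.
by move=> n; apply: Ck_cst; exact: openT.
Qed.

Lemma smooth_on_op2 (V W1 W2 W : normedModType R) (op : W1 -> W2 -> W)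
    (A : set V) (f : V -> W1) (g : V -> W2) :
  (forall n U f g, open U -> Ck n U f -> Ck n U g -> Ck n U (fun x : V => op (f x) (g x))) ->
  smooth_on A f -> smooth_on A g -> smooth_on A (fun x => op (f x) (g x)).
Proof.
move=> H sf sg; apply: smooth_on_intro => x Ax.
have [U [F [Ux oU CF EF]]] := smooth_on_elim sf Ax.
have [U' [G [Ux' oU' CG EG]]] := smooth_on_elim sg Ax.
exists (U `&` U'), (fun x => op (F x) (G x)); split.
- by split.
- exact: openI.
- move=> n; apply: H; first exact: openI.
  + by apply: Ck_sub (CF n) => y [].
  + by apply: Ck_sub (CG n) => y [].
- by move=> y [Uy Uy'] Ay; rewrite EF // EG.
Qed.

Lemma smooth_onD (V W : normedModType R) (A : set V) (f g : V -> W) :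
  smooth_on A f -> smooth_on A g -> smooth_on A (fun x => f x + g x).
Proof. by apply: smooth_on_op2 => *; exact: CkD. Qed.

Lemma smooth_onM (V : normedModType R) (A : set V) (f g : V -> R) :
  smooth_on A f -> smooth_on A g -> smooth_on A (fun x => f x * g x).
Proof. by apply: smooth_on_op2 => *; exact: CkM. Qed.

Lemma smooth_onX (V : normedModType R) (A : set V) (f : V -> R) n :
  smooth_on A f -> smooth_on A (fun x => f x ^+ n).
Proof.
move=> sf; elim: n => [|n IH]; first exact: smooth_on_cst.
by apply: smooth_on_ext (smooth_onM sf IH) => x _; rewrite exprS.
Qed.

Lemma smooth_onN (V : normedModType R) (A : set V) (f : V -> R) :
  smooth_on A f -> smooth_on A (fun x => - f x).
Proof.
move=> sf; have := smooth_onM (@smooth_on_cst V R A (-1)) sf.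
by apply: smooth_on_ext => x _; rewrite mulN1r.
Qed.

Lemma smooth_on_sum (V W : normedModType R) (A : set V) (I : Type) (s : seq I)
    (f : I -> V -> W) :
  (forall i, smooth_on A (f i)) -> smooth_on A (fun x => \sum_(i <- s) f i x).
Proof.
move=> sf; elim: s => [|i s IH].
  by apply: smooth_on_ext (@smooth_on_cst V W A 0) => x _; rewrite big_nil.
by apply: smooth_on_ext (smooth_onD (sf i) IH) => x _; rewrite big_cons.
Qed.

Lemma smooth_on_lin (V W Z : normedModType R) (A : set V) (f : V -> W)
    (c : {linear W -> Z}) :
  continuous c -> smooth_on A f -> smooth_on A (fun x => c (f x)).
Proof.
move=> cc sf; apply: smooth_on_intro => x Ax.
have [U [F [Ux oU CF EF]]] := smooth_on_elim sf Ax.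
exists U, (fun x => c (F x)); split=> //.
  by move=> n; exact: Ck_lin.
by move=> y Uy Ay; rewrite EF.
Qed.

(** Nothing controls an extension [F] off [A]; shrinking [U] to the preimage of [O] makes [F]
    nonzero, positive, or valued in the domain of a second map on all of [U], as inverses, square
    roots and compositions require. *)
Lemma smooth_on_restrict (V W : normedModType R) (A : set V) (f : V -> W)
    (O : set W) x : open O -> smooth_on A f -> A x -> O (f x) ->
  exists (U : set V) (F : V -> W), [/\ U x, open U,
     (forall n, Ck n U F), (forall y, U y -> O (F y))
     & forall y, U y -> A y -> F y = f y].
Proof.
move=> oO sf Ax Ofx.
have [U [F [Ux oU CF EF]]] := smooth_on_elim sf Ax.
exists (U `&` F @^-1` O), F; split.
- by split=> //=; rewrite EF.
- exact: (Ck_preimage_open oU oO (CF 0%N)).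
- by move=> n; apply: Ck_sub (CF n) => y [].
- by move=> y [].
- by move=> y [Uy _]; exact: EF.
Qed.

Lemma open_neq (b : R) : open [set y : R | y != b].
Proof.
rewrite (_ : mkset _ = ~` [set b]); first exact/closed_openC/closed_eq.
by apply/seteqP; split=> y /eqP.
Qed.

Lemma smooth_onV (V : normedModType R) (A : set V) (f : V -> R) :
  (forall x, A x -> f x != 0) -> smooth_on A f ->
  smooth_on A (fun x => (f x)^-1).
Proof.
move=> f0 sf; apply: smooth_on_intro => x Ax.
have [U [F [Ux oU CF OF EF]]] := smooth_on_restrict (@open_neq 0) sf Ax (f0 _ Ax).
exists U, (fun x => (F x)^-1); split=> //.
  by move=> n; exact: CkV.
by move=> y Uy Ay; rewrite EF.
Qed.

Lemma smooth_on_sqrt (V : normedModType R) (A : set V) (f : V -> R) :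
  (forall x, A x -> 0 < f x) -> smooth_on A f ->
  smooth_on A (fun x => Num.sqrt (f x)).
Proof.
move=> f0 sf; apply: smooth_on_intro => x Ax.
have [U [F [Ux oU CF OF EF]]] := smooth_on_restrict (@open_gt R 0) sf Ax (f0 _ Ax).
exists U, (fun x => Num.sqrt (F x)); split=> //.
  by move=> n; exact: Ck_sqrt.
by move=> y Uy Ay; rewrite EF.
Qed.

Lemma smooth_on_comp (V W Z : normedModType R) {fW : framed W} {fZ : framed Z}
    (A : set V) (B : set W) (f : V -> W) (g : W -> Z) :
  (forall x, A x -> B (f x)) ->
  smooth_on B g -> smooth_on A f -> smooth_on A (fun x => g (f x)).
Proof.
move=> AB sg sf; apply: smooth_on_intro => x Ax.
have [N [G [Ox oO CG EG]]] := smooth_on_elim sg (AB _ Ax).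
have [U [F [Ux oU CF OF EF]]] := smooth_on_restrict oO sf Ax Ox.
have [I [e [c frW]]] := fW; have [J [e' [c' frZ]]] := fZ.
exists U, (fun x => G (F x)); split=> //.
  by move=> n; apply: (Ck_comp frW frZ oU oO OF) => //.
move=> y Uy Ay; rewrite EF // EG //; last exact: AB.
by rewrite -EF //; exact: OF.
Qed.

Lemma Ck_id n (V : normedModType R) : Ck n [set: V] (fun x => x).
Proof.
case: n => [|n]; split=> // v.
apply: (Ck_eq openT _ (Ck_cst n v openT)) => y _.
by rewrite derive_id.
Qed.

Lemma smooth_on_id (V : normedModType R) (A : set V) : smooth_on A (fun x => x).
Proof.
apply: smooth_on_intro => x _; exists setT, id; split=> //; first exact: openT.
by move=> n; exact: Ck_id.
Qed.

Lemma smooth_on_fst (V W Z : normedModType R) (A : set V) (f : V -> W * Z) :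
  smooth_on A f -> smooth_on A (fun x => (f x).1).
Proof. by apply: smooth_on_lin; exact: fst_continuous. Qed.

Lemma smooth_on_snd (V W Z : normedModType R) (A : set V) (f : V -> W * Z) :
  smooth_on A f -> smooth_on A (fun x => (f x).2).
Proof. by apply: smooth_on_lin; exact: snd_continuous. Qed.

Lemma smooth_on_pair (V W Z : normedModType R) (A : set V) (f : V -> W)
    (g : V -> Z) :
  smooth_on A f -> smooth_on A g -> smooth_on A (fun x => (f x, g x)).
Proof.
move=> sf sg.
have := smooth_onD (smooth_on_lin (@pairl_continuous R W Z) sf)
  (smooth_on_lin (@pairr_continuous R W Z) sg).
by apply: smooth_on_ext => x _; congr pair; rewrite /= ?addr0 ?add0r.
Qed.

Lemma smooth_on_coord (V : normedModType R) m n (A : set V) (f : V -> 'M[R]_(m, n)) i j :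
  smooth_on A f -> smooth_on A (fun x => f x i j).
Proof.
have @c : {linear 'M[R]_(m, n) -> R}.
  by exists (fun N : 'M[R]_(_, _) => N i j); do 2![eexists]; do ?[constructor];
     rewrite ?mxE// => ? *; rewrite ?mxE//; move=> ?; rewrite !mxE.
move=> sf; exact: (@smooth_on_lin _ _ _ _ _ c (@coord_continuous _ _ _ i j) sf).
Qed.

Lemma smooth_on_mx (V : normedModType R) m n (A : set V) (f : V -> 'I_m -> 'I_n -> R) :
  (forall i j, smooth_on A (fun x => f x i j)) ->
  smooth_on A (fun x => \matrix_(i, j) f x i j).
Proof.
move=> sf.
have H (p : 'I_m * 'I_n) : smooth_on A (fun x => f x p.1 p.2 *: (delta_mx p.1 p.2 : 'M[R]_(m, n))).
  have sx_lin : linear ( *:%R ^~ (delta_mx p.1 p.2) : R -> 'M[R]_(m, n)).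
    by move=> u y z; rewrite scalerDl scalerA.
  pose sxlM := GRing.isLinear.Build _ _ _ _ _ sx_lin.
  pose sxL : {linear R -> 'M[R]_(m, n)} := HB.pack ( *:%R ^~ (delta_mx p.1 p.2)) sxlM.
  by apply: (@smooth_on_lin _ _ _ _ _ sxL); [exact/scalel_continuous|exact: sf].
apply: smooth_on_ext (smooth_on_sum (index_enum _) H) => x _.
rewrite [RHS]matrix_sum_delta pair_big /=.
by apply: eq_bigr => p _; rewrite mxE.
Qed.

Lemma smooth_on_dot (V : normedModType R) n (A : set V) (f g : V -> 'rV[R]_n) :
  smooth_on A f -> smooth_on A g -> smooth_on A (fun x => dot (f x) (g x)).
Proof.
move=> sf sg; apply: smooth_on_sum => i.
by apply: smooth_onM; exact: smooth_on_coord.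
Qed.

End SmoothOn.

(** * Division of a smooth function of one variable by a zero *)

Section Hadamard.
Context {R : realType}.

(** Absolute values treat both sides of [b] at once, which suits estimates on a ball around [b]. *)
Lemma MVT_abs (f df : R -> R) (b t : R) :
  (forall s, `|s - b| <= `|t - b| -> is_derive s 1 f (df s)) ->
  exists2 c, `|c - b| <= `|t - b| & f t - f b = df c * (t - b).
Proof.
move=> H.
have [bt|tb] := leP b t.
  have Hs s : s \in `[b, t] -> is_derive s 1 f (df s).
    rewrite in_itv /= => /andP[bs st]; apply: H.
    by rewrite !ger0_norm ?subr_ge0 // lerD2r.
  have Ho s : s \in `]b, t[ -> is_derive s 1 f (df s).
    rewrite in_itv /= => /andP[bs st].
    by apply: Hs; rewrite in_itv /= !ltW.
  have Hc : {within `[b, t], continuous f}.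
    by apply: derivable_within_continuous => s /Hs [].
  have [c] := MVT_segment bt Ho Hc.
  rewrite in_itv /= => /andP[bc ct] E; exists c => //.
  by rewrite !ger0_norm ?subr_ge0 // lerD2r.
have Hs s : s \in `[t, b] -> is_derive s 1 f (df s).
  rewrite in_itv /= => /andP[ts sb]; apply: H.
  by rewrite distrC [leRHS]distrC !ger0_norm ?subr_ge0 // ?lerB // ltW.
have Ho s : s \in `]t, b[ -> is_derive s 1 f (df s).
  rewrite in_itv /= => /andP[bs st].
  by apply: Hs; rewrite in_itv /= !ltW.
have Hc : {within `[t, b], continuous f}.
  by apply: derivable_within_continuous => s /Hs [].
have [c] := MVT_segment (ltW tb) Ho Hc.
rewrite in_itv /= => /andP[tc cb] E; exists c => //.
  by rewrite distrC [leRHS]distrC !ger0_norm ?subr_ge0 // ?lerB // ltW.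
by rewrite -opprB E -mulrN opprB.
Qed.

Definition Dn (n : nat) (f : R -> R) : R -> R := iter n (fun g : R -> R => 'D_1 g) f.

Lemma DnSr n f : Dn n.+1 f = Dn n ('D_1 f).
Proof. by rewrite /Dn iterSr. Qed.

Lemma smooth_D1 (U : set R) (f : R -> R) :
  (forall n, Ck n U f) -> forall n, Ck n U ('D_1 f).
Proof. by move=> H n; have [_] := H n.+1; apply. Qed.

Lemma smooth_Dn (U : set R) (f : R -> R) m :
  (forall n, Ck n U f) -> forall n, Ck n U (Dn m f).
Proof. by elim: m f => [//|m IH] f H; rewrite DnSr; apply/IH/smooth_D1. Qed.

Lemma Ck_is_derive n (U : set R) (f : R -> R) x :
  Ck n U f -> U x -> is_derive x 1 f ('D_1 f x).
Proof.
move=> Cf Ux; apply: derivableP; apply: diff_derivable.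
exact: Ck_differentiable Cf Ux.
Qed.

Lemma is_deriveD_fun (f g : R -> R) (x df dg : R) :
  is_derive x 1 f df -> is_derive x 1 g dg ->
  is_derive x 1 (fun y => f y + g y) (df + dg).
Proof. exact: is_deriveD. Qed.

Lemma is_deriveB_fun (f g : R -> R) (x df dg : R) :
  is_derive x 1 f df -> is_derive x 1 g dg ->
  is_derive x 1 (fun y => f y - g y) (df - dg).
Proof. exact: is_deriveB. Qed.

Lemma is_deriveM_fun (f g : R -> R) (x df dg : R) :
  is_derive x 1 f df -> is_derive x 1 g dg ->
  is_derive x 1 (fun y => f y * g y) (f x * dg + g x * df).
Proof. exact: is_deriveM. Qed.

Lemma is_derive_cst_fun (c x : R) : is_derive x 1 (fun _ : R => c) 0.
Proof. exact: is_derive_cst. Qed.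

Lemma is_derive_sub (b x : R) : is_derive x 1 (fun y : R => y - b) 1.
Proof.
by have := is_deriveB_fun (is_derive_id x 1) (is_derive_cst_fun b x); rewrite subr0.
Qed.

Lemma is_derive_monomial (c b : R) m (x : R) :
  is_derive x 1 (fun y : R => c * (y - b) ^+ m.+1) (c * (m.+1%:R * (x - b) ^+ m)).
Proof.
have := is_deriveX m.+1 (is_derive_sub b x); rewrite exprfctE => dX.
have := is_deriveM_fun (is_derive_cst_fun c x) dX.
by rewrite mulr0 addr0 /GRing.scale /= mulr1.
Qed.

(** The coefficients below order [m] vanish, and two more are kept: divided by [(t - b) ^ m], they
    are the value and the derivative of the quotient at [b]. The induction uses that the derivative
    of the remainder of [F] is the remainder of ['D_1 F] one order lower, and the mean value theorem
    carries the estimate back. *)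
Lemma taylor_remainder (U : set R) (F : R -> R) b m :
  open U -> U b -> (forall n, Ck n U F) ->
  (forall j, (j < m)%N -> Dn j F b = 0) ->
  forall e, 0 < e -> \forall t \near b,
    `|F t - Dn m F b / m`!%:R * (t - b) ^+ m
          - Dn m.+1 F b / m.+1`!%:R * (t - b) ^+ m.+1| <= e * `|t - b| ^+ m.+1.
Proof.
move=> oU Ub; elim: m F => [|m IH] F CF F0 e e0.
  have dF : differentiable F b by exact: Ck_differentiable (CF 0%N) Ub.
  have := diff_locallyx dF => /funext /eqaddoP /(_ _ e0).
  rewrite near_simpl (near_shift b) /=; apply: filterS => t /=.
  rewrite !fctE /= sub0r subrK !fact0 expr0 divr1 mulr1 expr1 divr1 /Dn /=.
  have -> : 'd F b (t - b) = 'D_1 F b * (t - b).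
    rewrite deriveE // -{1}[t - b]mulr1 -[RHS]mulrC.
    by rewrite -[_ * _ in LHS]/((t - b) *: (1 : R)) linearZ.
  by rewrite opprD addrA.
have F0' j : (j < m)%N -> Dn j ('D_1 F) b = 0 by move=> jm; rewrite -DnSr F0.
have Fb : F b = 0 by exact: (F0 0%N).
have /nbhs_ballP[d /= d0 Hd] : nbhs b [set t | U t /\ `|'D_1 F t - Dn m ('D_1 F) b / m`!%:R * (t - b) ^+ m
          - Dn m.+1 ('D_1 F) b / m.+1`!%:R * (t - b) ^+ m.+1| <= e * `|t - b| ^+ m.+1].
  apply: filterI; first exact: open_nbhs_nbhs.
  exact: (IH _ (smooth_D1 CF) F0' e e0).
apply/nbhs_ballP; exists d => // t /= dt.
set c1 := Dn m.+1 F b / _; set c2 := Dn m.+2 F b / _.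
pose G s := F s - c1 * (s - b) ^+ m.+1 - c2 * (s - b) ^+ m.+2.
pose G' s := 'D_1 F s - c1 * (m.+1%:R * (s - b) ^+ m) - c2 * (m.+2%:R * (s - b) ^+ m.+1).
have ball_s s : `|s - b| <= `|t - b| -> ball b d s.
  by move: dt; rewrite -!ball_normE /= !(distrC b) => tl sl; exact: le_lt_trans sl tl.
have dG s : `|s - b| <= `|t - b| -> is_derive s 1 G (G' s).
  move=> /ball_s /Hd [Us _].
  have dFs := Ck_is_derive (CF 0%N) Us.
  have dl c m' := is_derive_monomial c b m' s.
  exact: (is_deriveB_fun (is_deriveB_fun dFs (dl _ _)) (dl _ _)).
have [c ct E] := MVT_abs dG.
have [_ Hc] := Hd _ (ball_s _ ct).
have Gb : G b = 0 by rewrite /G Fb subrr !expr0n /= !mulr0 !subr0.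
have -> : F t - c1 * (t - b) ^+ m.+1 - c2 * (t - b) ^+ m.+2 = G' c * (t - b).
  by rewrite -E Gb subr0.
rewrite normrM exprSr mulrA ler_wpM2r //.
apply: le_trans (_ : e * `|c - b| ^+ m.+1 <= _).
  move: Hc; rewrite -!DnSr; congr (`|_| <= _).
  (* The factors produced by differentiating the monomials cancel against the factorials, for
     instance [(m + 1) / (m + 1)! = 1 / m!]. *)
  rewrite /G' /c1 /c2 (factS m.+1) (factS m) !natrM !invfM.
  have m1 : m.+1%:R != 0 :> R by rewrite pnatr_eq0.
  have m2 : m.+2%:R != 0 :> R by rewrite pnatr_eq0.
  have mf : (m`!)%:R != 0 :> R by rewrite pnatr_eq0 -lt0n fact_gt0.
  rewrite -[Dn m.+2 F b]/('D_1 (Dn m.+1 F) b) -[Dn m.+1 F b]/('D_1 (Dn m F) b).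
  move: ('D_1 (Dn m.+1 F) b) ('D_1 (Dn m F) b) (m.+1%:R : R) (m.+2%:R : R) m1 m2.
  move: (m`!%:R : R) mf ((c - b) ^+ m) ((c - b) ^+ m.+1) ('D_1 F c).
  by move=> f0 mf X Y Z d2 d1 n1 n2 m1 m2; field; rewrite mf m1 m2.
by rewrite ler_wpM2l ?(ltW e0) // lerXn2r // nnegrE.
Qed.

(* The quotients [F / (t - b) ^ k], extended at [b] by the Taylor coefficient of
   [F], are closed under differentiation: raise [k] and change the numerator to
   [quotient_num]. The case [k = 1] alone is not. *)
Definition quotient_pow (b : R) (k : nat) (F : R -> R) (t : R) : R :=
  if t == b then Dn k F b / k`!%:R else F t / (t - b) ^+ k.

Definition quotient_num (b : R) (k : nat) (F : R -> R) (t : R) : R :=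
  'D_1 F t * (t - b) - k%:R * F t.

(** Leibniz with the factor [t - b], whose second derivative is 0. At [b] only [(j - k)] times the
    [j]-th derivative of [F] survives: it is 0 for [j < k] if [F] vanishes to order [k], and also
    for [j = k]. So the new numerator vanishes to order [k + 1]. *)
Lemma Dn_quotient_num (U : set R) b k (F : R -> R) j x :
  open U -> (forall n, Ck n U F) -> U x ->
  Dn j (quotient_num b k F) x = Dn j.+1 F x * (x - b) + (j%:R - k%:R) * Dn j F x.
Proof.
move=> oU CF; elim: j x => [|j IH] x Ux.
  by rewrite /= /quotient_num sub0r mulNr.
have d1 := Ck_is_derive (smooth_Dn j CF 0%N) Ux.
have d2 := Ck_is_derive (smooth_Dn j.+1 CF 0%N) Ux.
rewrite [LHS](_ : _ = 'D_1 (fun y => Dn j.+1 F y * (y - b) + (j%:R - k%:R) * Dn j F y) x).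
  have := is_deriveD_fun (is_deriveM_fun d2 (is_derive_sub b x))
    (is_deriveM_fun (is_derive_cst_fun (j%:R - k%:R) x) d1).
  move=> /@derive_val ->; rewrite /= mulr1 mulr0 addr0.
  by rewrite -natr1 mulrC; ring.
apply: near_eq_derive; near=> y; apply: IH; near: y; exact: open_nbhs_nbhs.
Unshelve. all: by end_near. Qed.

Lemma is_derive_quotient_pow (U : set R) b k (F : R -> R) (x : R) :
  open U -> U b -> (forall n, Ck n U F) -> (forall j, (j < k)%N -> Dn j F b = 0) ->
  U x ->
  is_derive x 1 (quotient_pow b k F) (quotient_pow b k.+1 (quotient_num b k F) x).
Proof.
move=> oU Ub CF F0 Ux; rewrite {2}/quotient_pow.
have [->{x Ux}|xb] := eqVneq x b.
  rewrite (Dn_quotient_num _ _ _ oU CF Ub) subrr mulr0 add0r.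
  (* With this factor 1, [L] is exactly the Taylor coefficient of order [k + 1] of [F], which the
     remainder estimate identifies as the limit of the difference quotients. *)
  have -> : k.+1%:R - k%:R = 1 :> R by rewrite -natr1 addrAC subrr add0r.
  rewrite mul1r; set L := _ / _.
  suff H : (fun h : R => h^-1 *: ((quotient_pow b k F \o shift b) (h *: (1 : R)) -
     quotient_pow b k F b)) @ (0 : R)^' --> L.
    by split; [apply/cvg_ex; exists L|apply: cvg_lim].
  apply/cvgrPdist_le => e e0.
  have := taylor_remainder oU Ub CF F0 e0.
  rewrite (near_shift 0) /= => H; rewrite near_withinE.
  apply: filterS H => h /=.
  rewrite subr0 /GRing.scale /= mulr1 addrK => H h0.
  rewrite /quotient_pow /= eqxx -subr_eq0 addrK (negbTE h0) -/L.
  move: H; rewrite -/L; set X := F (h + b); set c := _ / k`!%:R.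
  have hk : h ^+ k.+1 != 0 by rewrite expf_neq0.
  have hk' : h ^+ k != 0 by rewrite expf_neq0.
  have -> : X - c * h ^+ k - L * h ^+ k.+1 =
     - ((L - h^-1 * (X / h ^+ k - c)) * h ^+ k.+1).
    by rewrite exprS; field; rewrite h0 hk'.
  by rewrite normrN normrM normrX ler_pM2r // exprn_gt0 // normr_gt0.
have x0 : x - b != 0 by rewrite subr_eq0.
apply: (@near_eq_is_derive _ _ _ (fun y => F y * ((y - b) ^+ k)^-1)).
  apply: filterS (open_nbhs_nbhs (conj (@open_neq R b) xb)) => y /= yb.
  by rewrite /quotient_pow (negbTE yb).
have dF := Ck_is_derive (CF 0%N) Ux.
have dp := is_deriveX k (is_derive_sub b x); rewrite exprfctE in dp.
have pk0 : (x - b) ^+ k != 0 by rewrite expf_neq0.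
have dV : is_derive x 1 (fun y : R => ((y - b) ^+ k)^-1)
    (- (x - b) ^- k ^+ 2 * (k%:R * (x - b) ^+ k.-1)).
  split; first by apply: derivableV => //; exact: ex_derive.
  by rewrite deriveV // derive_val /GRing.scale /= mulr1 exprVn.
have := is_deriveM_fun dF dV; congr (is_derive _ _ _ _).
(* The predecessor [k.-1] in the derivative of the power is truncated at [k = 0], so that case is
   separate. *)
rewrite /quotient_num; case: k {F0 dp dV} pk0 => [|k] pk0 /=.
  by rewrite !expr0 expr1; field.
by rewrite !exprS; field; rewrite x0 /= expf_neq0.
Qed.

Lemma Ck_quotient_pow (U : set R) b k (F : R -> R) n :
  open U -> U b -> (forall n, Ck n U F) -> (forall j, (j < k)%N -> Dn j F b = 0) ->
  Ck n U (quotient_pow b k F).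
Proof.
move=> oU Ub; elim: n k F => [|n IH] k F CF F0; split=> //;
  try by move=> x Ux; apply/derivable1_diffP;
    have [] := is_derive_quotient_pow oU Ub CF F0 Ux.
move=> v.
have CN m : Ck m U (quotient_num b k F).
  have Cc (c : R) : Ck m U (fun=> c) by exact: Ck_cst.
  have Ci : Ck m U (fun t : R => t - b).
    by apply: CkD => //; apply: Ck_sub (@Ck_id R m R).
  have := CkD oU (CkM oU (smooth_D1 CF m) Ci) (CkM oU (Cc (- k%:R)) (CF m)).
  by apply: Ck_eq => // t _; rewrite /quotient_num mulNr.
have N0 j : (j < k.+1)%N -> Dn j (quotient_num b k F) b = 0.
  move=> jk; rewrite (Dn_quotient_num _ _ _ oU CF Ub) subrr mulr0 add0r.
  have [->|jk'] := eqVneq j k; first by rewrite subrr mul0r.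
  by rewrite F0 ?mulr0 // ltn_neqAle jk' -ltnS.
have Cv : Ck n U (fun=> v) by exact: Ck_cst.
have := CkM oU Cv (IH _ _ CN N0); apply: Ck_eq => // x Ux.
have D := is_derive_quotient_pow oU Ub CF F0 Ux.
have dq : differentiable (quotient_pow b k F) x by apply/derivable1_diffP; case: D.
rewrite deriveE // -[X in 'd _ _ X]mulr1 -[RHS]/('d (quotient_pow b k F) x (v *: 1)).
by rewrite linearZ -deriveE // derive_val.
Qed.

(* Hadamard's lemma. *)
Lemma smooth_on_factor (A : set R) (f : R -> R) (b : R) :
  A° b -> smooth_on A f -> f b = 0 ->
  exists q : R -> R, [/\ smooth_on A q, forall t, f t = (t - b) * q t
    & q b = 'D_1 f b].
Proof.
move=> Ab sf fb.
exists (fun t => if t == b then 'D_1 f b else f t / (t - b)); split; last by rewrite eqxx.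
  apply: smooth_on_intro => x Ax.
  have [xb|xb] := eqVneq x b.
    have [U [F [Ub oU CF EF]]] := smooth_on_elim sf (interior_subset Ab).
    (* [F] and [f] agree only inside [A]; their derivatives at [b] coincide because a whole
       neighbourhood of [b] lies in [A]. *)
    have oUA : open (U `&` A°) by apply: openI => //; exact: open_interior.
    have UAb : (U `&` A°) b by split.
    have CF' n : Ck n (U `&` A°) F by apply: Ck_sub (CF n) => y [].
    exists (U `&` A°), (quotient_pow b 1 F); split=> //; first by rewrite xb.
      move=> n; apply: Ck_quotient_pow => // -[|//] _ /=.
      by rewrite EF //; exact: interior_subset.
    move=> y [Uy Ay'] Ay; rewrite /quotient_pow; case: eqP => [_|_].
      rewrite -[1`!]/1%N divr1 /=; apply: near_eq_derive.
      near=> z; apply: EF; first by near: z; exact: open_nbhs_nbhs.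
      by near: z.
    by rewrite expr1 EF.
  have sq : smooth_on (A `&` [set y | y != b]) (fun t => f t / (t - b)).
    apply: smooth_onM.
      by apply: smooth_on_subset sf => y [].
    apply: smooth_onV; first by move=> y [_ yb]; rewrite subr_eq0.
    by apply: smooth_onD; [exact: smooth_on_id|exact: smooth_on_cst].
  have [U [F [Ux oU CF EF]]] := smooth_on_elim sq (conj Ax xb).
  have oU' : open (U `&` [set y : R | y != b]) by apply: openI => //; exact: open_neq.
  exists (U `&` [set y : R | y != b]), F; split=> //.
    by move=> n; apply: Ck_sub (CF n) => y [].
  by move=> y [Uy /= yb] Ay; rewrite (negbTE yb); apply: EF.
move=> t; case: eqP => [->|/eqP tb]; first by rewrite subrr mul0r fb.
by rewrite mulrCA divff ?mulr1 // subr_eq0.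
Unshelve. all: by end_near. Qed.
End Hadamard.

(** * Diffeomorphisms and the bookkeeping of disjoint unions *)

Section Diffeo.
Context {R : realType}.

Lemma diffeomorphic_trans (V W Z : normedModType R) {fV : framed V}
    {fW : framed W} {fZ : framed Z} (A : set V) (B : set W) (C : set Z) :
  diffeomorphic A B -> diffeomorphic B C -> diffeomorphic A C.
Proof.
move=> [f [g [fAB gBA [gf fg] sf sg]]] [f' [g' [fBC gCB [gf' fg'] sf' sg']]].
exists (fun x => f' (f x)), (fun z => g (g' z)); split.
- by move=> x Ax; apply: fBC; exact: fAB.
- by move=> z Cz; apply: gBA; exact: gCB.
- split=> [x Ax|z Cz]; first by rewrite gf' ?gf //; exact: fAB.
  by rewrite fg ?fg' //; exact: gCB.
- by apply: smooth_on_comp sf' sf => x Ax; exact: fAB.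
- by apply: smooth_on_comp sg sg' => z Cz; exact: gCB.
Qed.

Lemma diffeomorphic_subset (V W : normedModType R) (A A' : set V) (B B' : set W)
    (f : V -> W) (g : W -> V) :
  [/\ set_fun A B f, set_fun B A g,
      (forall x, A x -> g (f x) = x) /\ (forall y, B y -> f (g y) = y),
      smooth_on A f & smooth_on B g] ->
  B' `<=` B -> A' = A `&` f @^-1` B' -> diffeomorphic A' B'.
Proof.
move=> [fAB gBA [gf fg] sf sg] sB ->.
exists f, g; split.
- by move=> x [].
- move=> y B'y; split; first exact: gBA (sB _ B'y).
  by rewrite /= fg //; exact: sB.
- by split=> [x [Ax _]|y B'y]; [exact: gf|apply: fg; exact: sB].
- by apply: smooth_on_subset sf => x [].
- exact: smooth_on_subset sg.
Qed.

(** The open set is the largest one whose points in [A] are sent into [N]; the local extensions show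
    that it reaches every point of [A] with image in [N]. *)
Lemma smooth_on_preimage_open (V W : normedModType R) (A : set V) (f : V -> W)
    (N : set W) :
  smooth_on A f -> open N -> exists2 U : set V, open U &
    forall x, A x -> U x <-> N (f x).
Proof.
move=> sf oN.
exists (\bigcup_(U in [set U | open U /\ (forall x, A x -> U x -> N (f x))]) U).
  by apply: bigcup_open => U [].
move=> x Ax; split=> [[U [_ HU] Ux]|Nx]; first exact: HU.
have [U [F [Ux oU _ OF EF]]] := smooth_on_restrict oN sf Ax Nx.
exists U => //; split=> // y Ay Uy.
by rewrite -EF //; exact: OF.
Qed.

Lemma disjoint_union_diffeomorphic (V W : normedModType R) {fV : framed V}
    {fW : framed W} (A : set V) (B : set W) k l :
  diffeomorphic A B -> disjoint_union_S1xS2_S3 k l B ->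
  disjoint_union_S1xS2_S3 k l A.
Proof.
move=> [f [g fg_diff]] [P [EB tP oP P1 P2]].
have [fAB gBA [gf fg] sf sg] := fg_diff.
have PB i : P i `<=` B by rewrite EB => y Py; exists i.
have H i := diffeomorphic_subset fg_diff (PB i) erefl.
exists (fun i => A `&` f @^-1` (P i)); split.
- apply/seteqP; split=> [x Ax|x [i _ []//]].
  have := fAB _ Ax; rewrite EB => -[i _ Pi]; by exists i.
- move=> i j _ _ [x [[_ Pi] [_ Pj]]]; apply: tP => //.
  by exists (f x).
- move=> i; have [N oN EP] := oP i.
  have [U oU HU] := smooth_on_preimage_open sf oN.
  exists U => //; rewrite EP; apply/seteqP; split=> [x [Ax [_ Nx]]|x [Ax Ux]].
    by split=> //; apply/HU.
  by split=> //; split; [exact: fAB|apply/HU].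
- by move=> i; exact: diffeomorphic_trans (H _) (P1 i).
- by move=> i; exact: diffeomorphic_trans (H _) (P2 i).
Qed.

Lemma disjoint_union_set0 (V : normedModType R) :
  disjoint_union_S1xS2_S3 0 0 (set0 : set V).
Proof.
exists (fun _ => set0); split.
- by apply/seteqP; split=> x [].
- by move=> i j _ _ [x [[]]].
- by move=> i; exists set0; [exact: open0|rewrite setI0].
- by case.
- by case.
Qed.

Lemma disjoint_union_S1xS2 (V : normedModType R) (A : set V) :
  diffeomorphic A (@S1xS2 R) -> disjoint_union_S1xS2_S3 1 0 A.
Proof.
move=> dA; exists (fun _ => A); split.
- by apply/seteqP; split=> x; [move=> Ax; exists (inl ord0)|case].
- by move=> [i|[]//] [j|[]//] _ _ _; rewrite !ord1.
- by move=> i; exists setT; [exact: openT|rewrite setIT].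
- by [].
- by case.
Qed.

Lemma disjoint_union_S3 (V : normedModType R) (A : set V) :
  diffeomorphic A (@sphere R 3) -> disjoint_union_S1xS2_S3 0 1 A.
Proof.
move=> dA; exists (fun _ => A); split.
- by apply/seteqP; split=> x; [move=> Ax; exists (inr ord0)|case].
- by move=> [[]//|i] [[]//|j] _ _ _; rewrite !ord1.
- by move=> i; exists setT; [exact: openT|rewrite setIT].
- by case.
- by [].
Qed.

(** Reindexing that merges two families of pieces while counting the copies of S^1 x S^2 and of S^3
    separately. *)
Definition split_sum k1 k2 l1 l2 (i : 'I_(k1 + k2) + 'I_(l1 + l2)) :
    ('I_k1 + 'I_l1) + ('I_k2 + 'I_l2) :=
  match i with
  | inl i => match fintype.split i with inl a => inl (inl a) | inr b => inr (inl b) end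
  | inr i => match fintype.split i with inl a => inl (inr a) | inr b => inr (inr b) end
  end.

Definition unsplit_sum k1 k2 l1 l2 (i : ('I_k1 + 'I_l1) + ('I_k2 + 'I_l2)) :
    'I_(k1 + k2) + 'I_(l1 + l2) :=
  match i with
  | inl (inl a) => inl (unsplit (inl a))
  | inr (inl b) => inl (unsplit (inr b))
  | inl (inr a) => inr (unsplit (inl a))
  | inr (inr b) => inr (unsplit (inr b))
  end.

Lemma split_sumK k1 k2 l1 l2 : cancel (@split_sum k1 k2 l1 l2) (@unsplit_sum k1 k2 l1 l2).
Proof. by case=> i /=; rewrite -[i in RHS]splitK; case: fintype.split. Qed.

Lemma unsplit_sumK k1 k2 l1 l2 : cancel (@unsplit_sum k1 k2 l1 l2) (@split_sum k1 k2 l1 l2).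
Proof. by case=> -[] i; rewrite /unsplit_sum /split_sum unsplitK. Qed.

Lemma disjoint_unionU (V : normedModType R) (A U1 U2 : set V) k1 l1 k2 l2 :
  open U1 -> open U2 -> A `<=` U1 `|` U2 -> A `&` U1 `&` U2 = set0 ->
  disjoint_union_S1xS2_S3 k1 l1 (A `&` U1) ->
  disjoint_union_S1xS2_S3 k2 l2 (A `&` U2) ->
  disjoint_union_S1xS2_S3 (k1 + k2) (l1 + l2) A.
Proof.
move=> o1 o2 AU A0 [P1 [E1 t1 oP1 PA1 PB1]] [P2 [E2 t2 oP2 PA2 PB2]].
pose P i := match @split_sum k1 k2 l1 l2 i with inl a => P1 a | inr b => P2 b end.
have s1 i : P1 i `<=` A `&` U1 by rewrite E1 => x Px; exists i.
have s2 i : P2 i `<=` A `&` U2 by rewrite E2 => x Px; exists i.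
have HPl i : P (unsplit_sum (inl i)) = P1 i by rewrite /P unsplit_sumK.
have HPr i : P (unsplit_sum (inr i)) = P2 i by rewrite /P unsplit_sumK.
exists P; split.
- apply/seteqP; split=> [x Ax|x [i _]]; last first.
    by rewrite /P; case: split_sum => a; [move/s1|move/s2]; case.
  case: (AU _ Ax) => Ux.
    have : (A `&` U1) x by []. rewrite E1 => -[i _ Pi]; exists (unsplit_sum (inl i)) => //.
    by rewrite HPl.
  have : (A `&` U2) x by []. rewrite E2 => -[i _ Pi]; exists (unsplit_sum (inr i)) => //.
  by rewrite HPr.
- move=> i j _ _; rewrite -(split_sumK i) -(split_sumK j).
  case: (split_sum i) => a; case: (split_sum j) => b; rewrite ?HPl ?HPr => -[x [Px Py]].
  + by rewrite (t1 a b) //; exists x.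
  + exfalso; have : (A `&` U1 `&` U2) x by have [] := s1 _ _ Px; have [] := s2 _ _ Py.
    by rewrite A0.
  + exfalso; have : (A `&` U1 `&` U2) x by have [] := s2 _ _ Px; have [] := s1 _ _ Py.
    by rewrite A0.
  + by rewrite (t2 a b) //; exists x.
- move=> i; rewrite /P; case: (split_sum i) => a.
    have [U oU ->] := oP1 a; exists (U1 `&` U); first exact: openI.
    by rewrite setIA.
  have [U oU ->] := oP2 a; exists (U2 `&` U); first exact: openI.
  by rewrite setIA.
- by move=> i; rewrite /P /=; case: fintype.split.
- by move=> i; rewrite /P /=; case: fintype.split.
Qed.
End Diffeo.

(** * Vectors given by lists of coordinates *)

Section Vectors.
Context {R : realType}.

Definition vec n (s : seq R) : 'rV[R]_n := \matrix_(i, j) s`_j.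

Lemma vecE n (s : seq R) i j : vec n s i j = s`_j.
Proof. by rewrite mxE. Qed.

Lemma smooth_on_vec (V : normedModType R) n (A : set V) (s : V -> seq R) :
  (forall j : 'I_n, smooth_on A (fun x => (s x)`_j)) ->
  smooth_on A (fun x => vec n (s x)).
Proof. by move=> sf; apply: smooth_on_mx => i j; exact: sf. Qed.

Lemma vec3_eta (u : 'rV[R]_3) : u = vec 3 [:: u 0 0; u 0 1; u 0 2].
Proof.
apply/rowP => j; rewrite vecE; case: j => -[|[|[|//]]] j3 /=; congr (u 0 _); exact: val_inj.
Qed.

Lemma vec2_eta (u : 'rV[R]_2) : u = vec 2 [:: u 0 0; u 0 1].
Proof.
apply/rowP => j; rewrite vecE; case: j => -[|[|//]] j3 /=; congr (u 0 _); exact: val_inj.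
Qed.

Lemma vec4_eta (u : 'rV[R]_4) : u = vec 4 [:: u 0 0; u 0 1; u 0 2; u 0 3].
Proof.
apply/rowP => j; rewrite vecE; case: j => -[|[|[|[|//]]]] j3 /=; congr (u 0 _); exact: val_inj.
Qed.

Lemma dot2E (u v : 'rV[R]_2) : dot u v = u 0 0 * v 0 0 + u 0 1 * v 0 1.
Proof.
by rewrite {1}[u]vec2_eta {1}[v]vec2_eta /dot !big_ord_recl big_ord0 !vecE /= addr0.
Qed.

Lemma dot3E (u v : 'rV[R]_3) :
  dot u v = u 0 0 * v 0 0 + u 0 1 * v 0 1 + u 0 2 * v 0 2.
Proof.
by rewrite {1}[u]vec3_eta {1}[v]vec3_eta /dot !big_ord_recl big_ord0 !vecE /= addr0 addrA.
Qed.

Lemma dot4E (u v : 'rV[R]_4) :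
  dot u v = u 0 0 * v 0 0 + u 0 1 * v 0 1 + u 0 2 * v 0 2 + u 0 3 * v 0 3.
Proof.
by rewrite {1}[u]vec4_eta {1}[v]vec4_eta /dot !big_ord_recl big_ord0 !vecE /= addr0 !addrA.
Qed.

End Vectors.

(** Constants are tried before the compound rules, so parameters close at once. The conditions that
    denominators are nonzero and radicands positive are left to the caller. *)
Ltac smooth_step :=
  first [ exact: smooth_on_id
        | exact: smooth_on_cst
        | apply: smooth_on_pair
        | apply: smooth_on_vec; do ![case=> //=] => _ 
        | apply: smooth_onD
        | apply: smooth_onN
        | apply: smooth_onM
        | apply: smooth_onX
        | apply: smooth_onV
        | apply: smooth_on_sqrt
        | apply: smooth_on_dot
        | apply: smooth_on_coord
        | apply: smooth_on_fst
        | apply: smooth_on_snd ].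
Ltac smooth := repeat smooth_step.

(** * The circle bundle, its trivialisation and its reflection *)

Section Pieces.
Context {R : realType}.
Implicit Types (f q : R -> R) (D : set R).

(* The circle bundle of tangent vectors of squared length [f] over the part of
   the unit sphere at heights in [D]; the circles shrink to points over the zeros
   of [f], and the fibers are empty where [f] is negative. *)
Definition bundle f D : set ('rV[R]_3 * 'rV[R]_3) :=
  [set x | [/\ dot x.2 x.2 = 1, dot x.1 x.2 = 0, dot x.1 x.1 = f (x.2 0 2)
             & D (x.2 0 2)]].

(** The trivialised form of [bundle], with the order of components reversed: the point of the sphere
    comes first, then the tangent vector read in R^2. *)
Definition chart f D : set ('rV[R]_3 * 'rV[R]_2) :=
  [set x | [/\ dot x.1 x.1 = 1, dot x.2 x.2 = f (x.1 0 2) & D (x.1 0 2)]].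

Lemma pole_neq0 (D : set R) t : (forall t, D t -> -1 < t) -> D t -> 1 + t != 0.
Proof. by move=> H /H; lra. Qed.

(* The minimal rotation taking the north pole to [r] identifies the tangent plane
   at [r] with R^2; it is undefined only at the south pole. *)
Lemma bundle_chart f D : (forall t, D t -> -1 < t) ->
  diffeomorphic (bundle f D) (chart f D).
Proof.
move=> D1.
pose F (x : 'rV[R]_3 * 'rV[R]_3) := (x.2, vec 2
  [:: x.1 0 0 - x.2 0 0 * x.1 0 2 / (1 + x.2 0 2);
      x.1 0 1 - x.2 0 1 * x.1 0 2 / (1 + x.2 0 2)]).
(* [G] applies the minimal rotation to [(w, 0)], and [F] is the inverse rotation, simplified by
   means of [<tau, r> = 0]. *)
pose G (y : 'rV[R]_3 * 'rV[R]_2) := (vec 3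
  [:: y.2 0 0 - y.1 0 0 * (y.1 0 0 * y.2 0 0 + y.1 0 1 * y.2 0 1) / (1 + y.1 0 2);
      y.2 0 1 - y.1 0 1 * (y.1 0 0 * y.2 0 0 + y.1 0 1 * y.2 0 1) / (1 + y.1 0 2);
      - (y.1 0 0 * y.2 0 0 + y.1 0 1 * y.2 0 1)], y.1).
exists F, G; split.
- move=> [t r] []; rewrite /= !dot3E => rr tr tt Dr.
  have r0 := pole_neq0 D1 Dr.
  split=> //=; first by rewrite dot3E.
  rewrite -tt dot2E !vecE /=.
  move: (r 0 0) (r 0 1) (r 0 2) (t 0 0) (t 0 1) (t 0 2) rr tr r0 => a b c x y z rr tr r0.
  apply: (mulfI (expf_neq0 2 r0)).
  rewrite [LHS](_ : _ = ((1 + c) * x - a * z) ^+ 2 + ((1 + c) * y - b * z) ^+ 2); last by field.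
  have rr' : a * a + b * b = 1 - c * c by lra.
  have tr' : x * a + y * b = - (z * c) by lra.
  rewrite [LHS](_ : _ = (1 + c) ^+ 2 * (x * x + y * y) - 2 * (1 + c) * z * (x * a + y * b)
    + z ^+ 2 * (a * a + b * b)); last by ring.
  by rewrite rr' tr'; ring.
- move=> [r w] []; rewrite /= dot3E !dot2E => rr ww Dr.
  have r0 := pole_neq0 D1 Dr.
  split=> //=; rewrite ?dot3E ?vecE //=.
    move: (r 0 0) (r 0 1) (r 0 2) (w 0 0) (w 0 1) rr r0 => a b c u v rr r0.
    apply: (mulfI r0); rewrite mulr0.
    have rr' : a * a + b * b = 1 - c * c by lra.
    rewrite [LHS](_ : _ = (a * u + b * v) * (1 + c - (a * a + b * b) - c * (1 + c))); last by field.
    by rewrite rr'; ring.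
  rewrite -ww.
  move: (r 0 0) (r 0 1) (r 0 2) (w 0 0) (w 0 1) rr r0 => a b c u v rr r0.
  apply: (mulfI (expf_neq0 2 r0)).
  have rr' : a * a + b * b = 1 - c * c by lra.
  rewrite [LHS](_ : _ = (1 + c) ^+ 2 * (u * u + v * v) + (a * u + b * v) ^+ 2 *
    ((a * a + b * b) - 2 * (1 + c) + (1 + c) ^+ 2)); last by field.
  by rewrite rr'; ring.
- split.
    move=> [t r] []; rewrite /= !dot3E => rr tr tt Dr.
    have r0 := pole_neq0 D1 Dr.
    rewrite /G /F /=; congr pair; rewrite !vecE /= [RHS]vec3_eta.
    move: (r 0 0) (r 0 1) (r 0 2) (t 0 0) (t 0 1) (t 0 2) rr tr r0 => a b c x y z rr tr r0.
    have E : a * (x - a * z / (1 + c)) + b * (y - b * z / (1 + c)) = - z.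
      apply: (mulfI r0).
      rewrite [LHS](_ : _ = (1 + c) * (x * a + y * b) - z * (a * a + b * b)); last by field.
      have -> : a * a + b * b = 1 - c * c by lra.
      have -> : x * a + y * b = - (z * c) by lra.
      by ring.
    by rewrite E opprK !mulrN !mulNr !opprK !subrK.
  move=> [r w] []; rewrite /= dot3E !dot2E => rr ww Dr.
  have r0 := pole_neq0 D1 Dr.
  rewrite /G /F /=; congr pair; rewrite !vecE /= [RHS]vec2_eta.
  by congr (vec _ [:: _ ; _]); rewrite mulrN mulNr opprK subrK.
- by smooth; move=> x [_ _ _ /(pole_neq0 D1)].
- by smooth; move=> x [_ _ /(pole_neq0 D1)].
Qed.

(** The trivialisation misses the south pole; the reflection in the equatorial plane brings a
    component containing that pole to the north, where it is available. *)
Lemma bundle_mirror f D :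
  diffeomorphic (bundle f D) (bundle (fun t => f (- t)) [set t | D (- t)]).
Proof.
pose F (x : 'rV[R]_3 * 'rV[R]_3) := (vec 3 [:: x.1 0 0; x.1 0 1; - x.1 0 2],
  vec 3 [:: x.2 0 0; x.2 0 1; - x.2 0 2]).
have FF x : F (F x) = x.
  by case: x => t r; rewrite /F /= !vecE /= !opprK -!vec3_eta.
exists F, F; split=> //.
- move=> [t r] []; rewrite /F /= !dot3E => rr tr tt Dr.
  by split; rewrite /= ?dot3E !vecE /= ?opprK // ?mulrNN.
- move=> [t r] []; rewrite /F /= !dot3E => rr tr tt Dr.
  by split; rewrite /= ?dot3E !vecE /= ?mulrNN.
- by smooth.
- by smooth.
Qed.

Lemma sphere3_le1 (r : 'rV[R]_3) : dot r r = 1 -> -1 <= r 0 2 <= 1.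
Proof.
rewrite dot3E; move: (r 0 0) (r 0 1) (r 0 2) => a b c rr.
have := sqr_ge0 a; have := sqr_ge0 b; rewrite !expr2 => a0 b0.
by apply/andP; split; nra.
Qed.

End Pieces.

(** * The component between two zeros *)

Section Band.
Context {R : realType}.
Implicit Types (f q : R -> R) (D : set R).

(** The horizontal part of [r] never vanishes, and its direction is the S^1 factor. With
    [t = (b + c + (c - b) * u) / 2] one has [(t - b) * (c - t) = ((c - b) / 2) ^ 2 * (1 - u ^ 2)],
    so [2 * w / ((c - b) * sqrt q)] together with [u] is a point of S^2. *)
Lemma chart_band f q D (b c : R) :
  -1 < b -> b < c -> c < 1 ->
  smooth_on [set t | b <= t <= c] q ->
  (forall t, b <= t <= c -> 0 < q t) ->
  (forall t, b <= t <= c -> f t = (t - b) * (c - t) * q t) ->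
  (forall t, D t -> 0 <= f t -> b <= t <= c) ->
  (forall t, b <= t <= c -> D t) ->
  diffeomorphic (chart f D) (@S1xS2 R).
Proof.
move=> b1 bc c1 sq q0 fq Dbc bcD.
pose F (x : 'rV[R]_3 * 'rV[R]_2) :=
  let k := Num.sqrt (1 - x.1 0 2 ^+ 2) in let m := (c - b) * Num.sqrt (q (x.1 0 2)) in
  (vec 2 [:: x.1 0 0 / k; x.1 0 1 / k],
   vec 3 [:: 2 * x.2 0 0 / m; 2 * x.2 0 1 / m; (2 * x.1 0 2 - b - c) / (c - b)]).
pose T (y : 'rV[R]_2 * 'rV[R]_3) := (b + c + (c - b) * y.2 0 2) / 2.
pose G (y : 'rV[R]_2 * 'rV[R]_3) :=
  let k := Num.sqrt (1 - T y ^+ 2) in let m := (c - b) * Num.sqrt (q (T y)) in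
  (vec 3 [:: y.1 0 0 * k; y.1 0 1 * k; T y], vec 2 [:: y.2 0 0 * m / 2; y.2 0 1 * m / 2]).
have cb0 : c - b != 0 by rewrite subr_eq0 gt_eqF.
have k0 t : b <= t <= c -> 0 < 1 - t ^+ 2 by move=> /andP[bt tc]; nra.
have chD x : chart f D x -> b <= x.1 0 2 <= c.
  move=> [rr ww Dx]; apply: Dbc => //; rewrite -ww dot2E.
  by rewrite addr_ge0 // -expr2 sqr_ge0.
have TD y : S1xS2 y -> b <= T y <= c.
  move=> [_ /= y2]; have := sphere3_le1 y2; rewrite /T => /andP[s1 s2].
  by apply/andP; split; nra.
have FS x : chart f D x -> S1xS2 (F x).
  move=> /[dup] xD [rr ww _]; have tbc := chD x xD.
  have := k0 _ tbc; have := q0 _ tbc; move: ww rr; rewrite (fq _ tbc) dot2E dot3E.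
  case: x {xD} tbc => r w /= tbc.
  rewrite /F /S1xS2 /sphere /= => ww rr qt kt.
  have kk : Num.sqrt (1 - r 0 2 ^+ 2) ^+ 2 = 1 - r 0 2 ^+ 2 by rewrite sqr_sqrtr // ltW.
  have qq : Num.sqrt (q (r 0 2)) ^+ 2 = q (r 0 2) by rewrite sqr_sqrtr // ltW.
  have k_neq0 : Num.sqrt (1 - r 0 2 ^+ 2) != 0 by rewrite gt_eqF // sqrtr_gt0.
  have q_neq0 : Num.sqrt (q (r 0 2)) != 0 by rewrite gt_eqF // sqrtr_gt0.
  rewrite /= dot2E dot3E !vecE /=.
  move: ww kk qq k_neq0 q_neq0 {qt kt}.
  move: (q _) (Num.sqrt (q _)) (Num.sqrt (1 - _)) => Q s k ww kk qq k_neq0 q_neq0.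
  move: (r 0 0) (r 0 1) (r 0 2) (w 0 0) (w 0 1) rr kk ww => x y t u v rr kk ww.
  split.
    apply: (mulfI (expf_neq0 2 k_neq0)).
    rewrite [LHS](_ : _ = x * x + y * y); last by field.
    by rewrite mulr1 kk; lra.
  have sc0 : ((c - b) * s) ^+ 2 != 0 by rewrite expf_neq0 // mulf_neq0.
  apply: (mulfI sc0).
  rewrite [LHS](_ : _ = 4 * (u * u + v * v) + s ^+ 2 * (2 * t - b - c) ^+ 2); last first.
    by field; rewrite cb0 q_neq0.
  by rewrite ww mulr1 exprMn qq; ring.
have GS y : S1xS2 y -> chart f D (G y).
  move=> /[dup] yS [y1 y2]; have tbc := TD y yS.
  have := k0 _ tbc; have := q0 _ tbc; move: (bcD _ tbc) (fq _ tbc).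
  case: y {yS} y1 y2 tbc => p s /=; rewrite /sphere /= dot2E dot3E => pp ss tbc.
  move=> DT fT qt kt.
  have kk : Num.sqrt (1 - T (p, s) ^+ 2) ^+ 2 = 1 - T (p, s) ^+ 2 by rewrite sqr_sqrtr // ltW.
  have qq : Num.sqrt (q (T (p, s))) ^+ 2 = q (T (p, s)) by rewrite sqr_sqrtr // ltW.
  rewrite /G; split; rewrite /= ?dot2E ?dot3E !vecE //=.
    rewrite [LHS](_ : _ = (p 0 0 * p 0 0 + p 0 1 * p 0 1) * Num.sqrt (1 - T (p, s) ^+ 2) ^+ 2
       + T (p, s) ^+ 2); last by ring.
    by rewrite pp kk; ring.
  rewrite fT [LHS](_ : _ = (s 0 0 * s 0 0 + s 0 1 * s 0 1) * (c - b) ^+ 2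
    * Num.sqrt (q (T (p, s))) ^+ 2 / 4); last by field.
  have -> : s 0 0 * s 0 0 + s 0 1 * s 0 1 = 1 - s 0 2 * s 0 2 by lra.
  by rewrite qq /T /=; field.
exists F, G; split.
- exact: FS.
- exact: GS.
- split=> [x xD|y yS].
    have tbc := chD x xD.
    have TF : T (F x) = x.1 0 2 by rewrite /T /F /= !vecE /=; field.
    have k_neq0 : Num.sqrt (1 - x.1 0 2 ^+ 2) != 0 by rewrite gt_eqF // sqrtr_gt0 k0.
    have q_neq0 : Num.sqrt (q (x.1 0 2)) != 0 by rewrite gt_eqF // sqrtr_gt0 q0.
    rewrite /G TF [RHS]surjective_pairing [x.1 in RHS]vec3_eta [x.2 in RHS]vec2_eta.
    rewrite /F /= !vecE /=; congr (vec _ [:: _; _; _], vec _ [:: _; _]); field=> //.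
    + by rewrite cb0 q_neq0.
    + by rewrite cb0 q_neq0.
  have tbc := TD y yS.
  have TF : (G y).1 0 2 = T y by rewrite /G /= !vecE.
  have k_neq0 : Num.sqrt (1 - T y ^+ 2) != 0 by rewrite gt_eqF // sqrtr_gt0 k0.
  have q_neq0 : Num.sqrt (q (T y)) != 0 by rewrite gt_eqF // sqrtr_gt0 q0.
  rewrite /F TF [RHS]surjective_pairing [y.1 in RHS]vec2_eta [y.2 in RHS]vec3_eta.
  rewrite /G /= !vecE /=; congr (vec _ [:: _; _], vec _ [:: _; _; _]); try field => //.
  + by rewrite cb0 q_neq0.
  + by rewrite cb0 q_neq0.
  + by rewrite /T; field.
- have sqx : smooth_on (chart f D) (fun x => q (x.1 0 2)).
    by apply: (smooth_on_comp chD sq); smooth.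
  rewrite /F; smooth => //.
  + by move=> x /chD/k0 h; rewrite gt_eqF // sqrtr_gt0.
  + by move=> x /chD/k0.
  + by move=> x /chD/k0 h; rewrite gt_eqF // sqrtr_gt0.
  + by move=> x /chD/k0.
  + by move=> x /chD/q0 h; rewrite mulf_neq0 // gt_eqF // sqrtr_gt0.
  + by move=> x /chD/q0.
  + by move=> x /chD/q0 h; rewrite mulf_neq0 // gt_eqF // sqrtr_gt0.
  + by move=> x /chD/q0.
- have sT : smooth_on (@S1xS2 R) T by rewrite /T; smooth.
  have sqT : smooth_on (@S1xS2 R) (fun x => q (T x)) by exact: (smooth_on_comp TD sq).
  rewrite /G; smooth => //.
  + by move=> x /TD/k0.
  + by move=> x /TD/k0.
  + by move=> x /TD/q0.
  + by move=> x /TD/q0.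
Qed.
End Band.

(** * The component around a pole *)

Section Cap.
Context {R : realType}.
Implicit Types (f q : R -> R) (D : set R).

(** S^3 is seen in R^2 x R^2. The horizontal part of [r] has squared length [(1 - t) * (1 + t)] and
    [w] has [(t - c) * q]; the chosen divisors turn these into [(1 - t) / (1 - c)] and
    [(t - c) / (1 - c)], whose sum is 1. The first one also gives [t] back as a polynomial, which is
    [T]. *)
Lemma chart_cap f q D (c : R) :
  -1 < c -> c < 1 ->
  smooth_on [set t | c <= t <= 1] q ->
  (forall t, c <= t <= 1 -> 0 < q t) ->
  (forall t, c <= t <= 1 -> f t = (t - c) * q t) ->
  (forall t, D t -> 0 <= f t -> c <= t) ->
  (forall t, c <= t <= 1 -> D t) ->
  diffeomorphic (chart f D) (@sphere R 3).
Proof.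
move=> c1 c2 sq q0 fq Dc cD.
pose F (x : 'rV[R]_3 * 'rV[R]_2) :=
  let k := Num.sqrt ((1 + x.1 0 2) * (1 - c)) in
  let m := Num.sqrt (q (x.1 0 2) * (1 - c)) in
  vec 4 [:: x.1 0 0 / k; x.1 0 1 / k; x.2 0 0 / m; x.2 0 1 / m].
pose T (y : 'rV[R]_4) := 1 - (1 - c) * (y 0 0 ^+ 2 + y 0 1 ^+ 2).
pose G (y : 'rV[R]_4) :=
  let k := Num.sqrt ((1 + T y) * (1 - c)) in
  let m := Num.sqrt (q (T y) * (1 - c)) in
  (vec 3 [:: y 0 0 * k; y 0 1 * k; T y], vec 2 [:: y 0 2 * m; y 0 3 * m]).
have c0 : 1 - c != 0 by rewrite subr_eq0 gt_eqF.
have k0 t : c <= t <= 1 -> 0 < (1 + t) * (1 - c) by move=> /andP[bt tc]; nra.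
have m0 t : c <= t <= 1 -> 0 < q t * (1 - c).
  by move=> /q0 qt; rewrite mulr_gt0 // subr_gt0.
have chD x : chart f D x -> c <= x.1 0 2 <= 1.
  move=> [rr ww Dx]; apply/andP; split; last by have /andP[] := sphere3_le1 rr.
  by apply: Dc => //; rewrite -ww dot2E addr_ge0 // -expr2 sqr_ge0.
have TD y : sphere y -> c <= T y <= 1.
  rewrite /sphere /= dot4E /T => y1; have := sqr_ge0 (y 0 0); have := sqr_ge0 (y 0 1).
  have := sqr_ge0 (y 0 2); have := sqr_ge0 (y 0 3); rewrite !expr2 => *.
  by apply/andP; split; nra.
have FS x : chart f D x -> sphere (F x).
  move=> /[dup] xD [rr ww _]; have tbc := chD x xD.
  have := k0 _ tbc; have := m0 _ tbc; move: ww rr; rewrite (fq _ tbc) dot2E dot3E.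
  case: x {xD} tbc => r w /= tbc.
  rewrite /F /sphere /= => ww rr mt kt.
  have kk : Num.sqrt ((1 + r 0 2) * (1 - c)) ^+ 2 = (1 + r 0 2) * (1 - c) by rewrite sqr_sqrtr // ltW.
  have mm : Num.sqrt (q (r 0 2) * (1 - c)) ^+ 2 = q (r 0 2) * (1 - c) by rewrite sqr_sqrtr // ltW.
  have k_neq0 : Num.sqrt ((1 + r 0 2) * (1 - c)) != 0 by rewrite gt_eqF // sqrtr_gt0.
  have m_neq0 : Num.sqrt (q (r 0 2) * (1 - c)) != 0 by rewrite gt_eqF // sqrtr_gt0.
  have r0 : 1 + r 0 2 != 0 by apply: contraTneq kt => ->; rewrite mul0r ltxx.
  have q_neq0 : q (r 0 2) != 0 by rewrite gt_eqF // q0.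
  rewrite dot4E !vecE /=.
  rewrite [LHS](_ : _ = (r 0 0 * r 0 0 + r 0 1 * r 0 1) / Num.sqrt ((1 + r 0 2) * (1 - c)) ^+ 2
    + (w 0 0 * w 0 0 + w 0 1 * w 0 1) / Num.sqrt (q (r 0 2) * (1 - c)) ^+ 2); last first.
    by field; rewrite k_neq0 m_neq0.
  rewrite kk mm ww; have -> : r 0 0 * r 0 0 + r 0 1 * r 0 1 = 1 - r 0 2 * r 0 2 by lra.
  by field; rewrite c0 q_neq0 r0.
have GS y : sphere y -> chart f D (G y).
  move=> /[dup] yS y1; have tbc := TD y yS.
  have := k0 _ tbc; have := m0 _ tbc; move: (cD _ tbc) (fq _ tbc).
  move: y1; rewrite /sphere /= dot4E => yy DT fT mt kt.
  have kk : Num.sqrt ((1 + T y) * (1 - c)) ^+ 2 = (1 + T y) * (1 - c) by rewrite sqr_sqrtr // ltW.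
  have mm : Num.sqrt (q (T y) * (1 - c)) ^+ 2 = q (T y) * (1 - c) by rewrite sqr_sqrtr // ltW.
  rewrite /G; split; rewrite /= ?dot2E ?dot3E !vecE //=.
    rewrite [LHS](_ : _ = (y 0 0 ^+ 2 + y 0 1 ^+ 2) * Num.sqrt ((1 + T y) * (1 - c)) ^+ 2
       + T y ^+ 2); last by ring.
    by rewrite kk /T; ring.
  rewrite fT [LHS](_ : _ = (y 0 2 * y 0 2 + y 0 3 * y 0 3) * Num.sqrt (q (T y) * (1 - c)) ^+ 2); last by ring.
  have -> : y 0 2 * y 0 2 + y 0 3 * y 0 3 = 1 - (y 0 0 ^+ 2 + y 0 1 ^+ 2).
    by rewrite !expr2; lra.
  by rewrite mm {2}/T; ring.
exists F, G; split.
- exact: FS.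
- exact: GS.
- split=> [x xD|y yS].
    have tbc := chD x xD.
    have k_neq0 : Num.sqrt ((1 + x.1 0 2) * (1 - c)) != 0 by rewrite gt_eqF // sqrtr_gt0 k0.
    have m_neq0 : Num.sqrt (q (x.1 0 2) * (1 - c)) != 0 by rewrite gt_eqF // sqrtr_gt0 m0.
    have TF : T (F x) = x.1 0 2.
      rewrite /T /F /= !vecE /=.
      rewrite [LHS](_ : _ = 1 - (1 - c) * (x.1 0 0 * x.1 0 0 + x.1 0 1 * x.1 0 1) / Num.sqrt ((1 + x.1 0 2) * (1 - c)) ^+ 2); last by field.
      have r0 : 1 + x.1 0 2 != 0.
        by have := k0 _ tbc; apply: contraTneq => ->; rewrite mul0r ltxx.
      rewrite sqr_sqrtr; last by rewrite ltW // k0.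
      have [] := xD; rewrite dot3E => rr _ _.
      have -> : x.1 0 0 * x.1 0 0 + x.1 0 1 * x.1 0 1 = 1 - x.1 0 2 * x.1 0 2 by lra.
      by field; rewrite c0 r0.
    rewrite /G TF [RHS]surjective_pairing [x.1 in RHS]vec3_eta [x.2 in RHS]vec2_eta.
    rewrite /F /= !vecE /=.
    by congr (vec _ [:: _; _; _], vec _ [:: _; _]); rewrite divfK.
  have tbc := TD y yS.
  have TF : (G y).1 0 2 = T y by rewrite /G /= !vecE.
  have k_neq0 : Num.sqrt ((1 + T y) * (1 - c)) != 0 by rewrite gt_eqF // sqrtr_gt0 k0.
  have m_neq0 : Num.sqrt (q (T y) * (1 - c)) != 0 by rewrite gt_eqF // sqrtr_gt0 m0.
  rewrite /F TF [RHS]vec4_eta.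
  by rewrite /G /= !vecE /=; congr (vec _ [:: _; _; _; _]); rewrite mulfK.
- have sqx : smooth_on (chart f D) (fun x => q (x.1 0 2)).
    by apply: (smooth_on_comp chD sq); smooth.
  rewrite /F; smooth => //.
  + by move=> x /chD/k0 h; rewrite gt_eqF // sqrtr_gt0.
  + by move=> x /chD/k0.
  + by move=> x /chD/k0 h; rewrite gt_eqF // sqrtr_gt0.
  + by move=> x /chD/k0.
  + by move=> x /chD/m0 h; rewrite gt_eqF // sqrtr_gt0.
  + by move=> x /chD/m0.
  + by move=> x /chD/m0 h; rewrite gt_eqF // sqrtr_gt0.
  + by move=> x /chD/m0.
- have sT : smooth_on (@sphere R 3) T by rewrite /T; smooth.
  have sqT : smooth_on (@sphere R 3) (fun x => q (T x)) by exact: (smooth_on_comp TD sq).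
  rewrite /G; smooth => //.
  + by move=> x /TD/k0.
  + by move=> x /TD/k0.
  + by move=> x /TD/m0.
  + by move=> x /TD/m0.
Qed.
End Cap.

(** * Rotation matrices and quaternions *)

Section Rotations.
Context {R : realType}.

(* Entries of [v^T *m v], where [v] is either of the two unit quaternions of the
   rotation with matrix [x_ij]. *)
Definition quaternion_proj (x11 x12 x13 x21 x22 x23 x31 x32 x33 : R) (i j : nat) : R :=
  (nth [::] [::
    [:: (1 + x11 + x22 + x33) / 4; (x32 - x23) / 4; (x13 - x31) / 4; (x21 - x12) / 4];
    [:: (x32 - x23) / 4; (1 + x11 - x22 - x33) / 4; (x12 + x21) / 4; (x13 + x31) / 4];
    [:: (x13 - x31) / 4; (x12 + x21) / 4; (1 - x11 + x22 - x33) / 4; (x23 + x32) / 4];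
    [:: (x21 - x12) / 4; (x13 + x31) / 4; (x23 + x32) / 4; (1 - x11 - x22 + x33) / 4]] i)`_j.

(** The second column is the cross product of the third and the first, so the matrix is a rotation.
    Every relation of degree two among its entries that is needed (entries as cofactors, orthonormal
    columns, orthonormal rows) is derived first; the rank-one identities are linear combinations of
    these. *)
Lemma quaternion_proj_rank1 (x11 x12 x13 x21 x22 x23 x31 x32 x33 : R) :
  x11 * x11 + x21 * x21 + x31 * x31 = 1 ->
  x13 * x13 + x23 * x23 + x33 * x33 = 1 ->
  x11 * x13 + x21 * x23 + x31 * x33 = 0 ->
  x12 = x23 * x31 - x33 * x21 ->
  x22 = x33 * x11 - x13 * x31 ->
  x32 = x13 * x21 - x23 * x11 ->
  let p := quaternion_proj x11 x12 x13 x21 x22 x23 x31 x32 x33 in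
  forall i j k, (i < 4)%N -> (j < 4)%N -> (k < 4)%N -> p i j * p i k = p i i * p j k.
Proof.
move=> C11 C33 C13 M1 M2 M3.
(* The [N] relations express the first column as the product of the second and third, the [L]
   relations the third as the product of the first and second. *)
have N1 : x22 * x33 - x23 * x32 = x11.
  rewrite M2 M3 [LHS](_ : _ = x11 * (x13 * x13 + x23 * x23 + x33 * x33) - x13 * (x11 * x13 + x21 * x23 + x31 * x33)); last by ring.
  by rewrite C33 C13; ring.
have N2 : x32 * x13 - x33 * x12 = x21.
  rewrite M1 M3 [LHS](_ : _ = x21 * (x13 * x13 + x23 * x23 + x33 * x33) - x23 * (x11 * x13 + x21 * x23 + x31 * x33)); last by ring.
  by rewrite C33 C13; ring.
have N3 : x12 * x23 - x13 * x22 = x31.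
  rewrite M1 M2 [LHS](_ : _ = x31 * (x13 * x13 + x23 * x23 + x33 * x33) - x33 * (x11 * x13 + x21 * x23 + x31 * x33)); last by ring.
  by rewrite C33 C13; ring.
have L1 : x21 * x32 - x31 * x22 = x13.
  rewrite M2 M3 [LHS](_ : _ = x13 * (x11 * x11 + x21 * x21 + x31 * x31) - x11 * (x11 * x13 + x21 * x23 + x31 * x33)); last by ring.
  by rewrite C11 C13; ring.
have L2 : x31 * x12 - x11 * x32 = x23.
  rewrite M1 M3 [LHS](_ : _ = x23 * (x11 * x11 + x21 * x21 + x31 * x31) - x21 * (x11 * x13 + x21 * x23 + x31 * x33)); last by ring.
  by rewrite C11 C13; ring.
have L3 : x11 * x22 - x21 * x12 = x33.
  rewrite M1 M2 [LHS](_ : _ = x33 * (x11 * x11 + x21 * x21 + x31 * x31) - x31 * (x11 * x13 + x21 * x23 + x31 * x33)); last by ring.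
  by rewrite C11 C13; ring.
have det1 : x11 * (x22 * x33 - x23 * x32) + x21 * (x32 * x13 - x33 * x12) + x31 * (x12 * x23 - x13 * x22) = 1.
  by rewrite N1 N2 N3.
have C22 : x12 * x12 + x22 * x22 + x32 * x32 = 1.
  by rewrite {1}M1 {1}M2 {1}M3 -det1; ring.
have C12 : x11 * x12 + x21 * x22 + x31 * x32 = 0.
  by rewrite M1 M2 M3; ring.
have C23 : x13 * x12 + x23 * x22 + x33 * x32 = 0.
  by rewrite M1 M2 M3; ring.
(* Replacing one entry of each product by its cofactor turns products of rows into the determinant
   on the diagonal, and into an expansion with a repeated row off it. *)
have R11 : x11 * x11 + x12 * x12 + x13 * x13 = 1.
  by rewrite -{1}N1 {1}M1 -{1}L1 -det1; ring.
have R22 : x21 * x21 + x22 * x22 + x23 * x23 = 1.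
  by rewrite -{1}N2 {1}M2 -{1}L2 -det1; ring.
have R33 : x31 * x31 + x32 * x32 + x33 * x33 = 1.
  by rewrite -{1}N3 {1}M3 -{1}L3 -det1; ring.
have R12 : x11 * x21 + x12 * x22 + x13 * x23 = 0.
  by rewrite -N1 M1 -L1; ring.
have R13 : x11 * x31 + x12 * x32 + x13 * x33 = 0.
  by rewrite -N1 M1 -L1; ring.
have R23 : x21 * x31 + x22 * x32 + x23 * x33 = 0.
  by rewrite -N2 M2 -L2; ring.
clear det1.
(* Each of the 64 cases is linear once the quadratic monomials are taken as atoms, so [lra] finds
   the combination. *)
move=> p [|[|[|[|//]]]] [|[|[|[|//]]]] [|[|[|[|//]]]] _ _ _; rewrite /p /quaternion_proj /=; lra.
Qed.
End Rotations.

(** * The unit tangent bundle and RP^3 *)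

Section ProjectiveSpace.
Context {R : realType}.

Lemma bundle_scale (f : R -> R) :
  smooth_on [set t : R | -1 <= t <= 1] f -> (forall t, -1 <= t <= 1 -> 0 < f t) ->
  diffeomorphic (bundle f setT) (bundle (fun=> 1 : R) setT).
Proof.
move=> sf f0.
pose F (x : 'rV[R]_3 * 'rV[R]_3) := (vec 3 [:: x.1 0 0 / Num.sqrt (f (x.2 0 2));
  x.1 0 1 / Num.sqrt (f (x.2 0 2)); x.1 0 2 / Num.sqrt (f (x.2 0 2))], x.2).
pose G (x : 'rV[R]_3 * 'rV[R]_3) := (vec 3 [:: x.1 0 0 * Num.sqrt (f (x.2 0 2));
  x.1 0 1 * Num.sqrt (f (x.2 0 2)); x.1 0 2 * Num.sqrt (f (x.2 0 2))], x.2).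
have bt g (x : 'rV[R]_3 * 'rV[R]_3) : bundle g setT x -> -1 <= x.2 0 2 <= 1.
  by move=> [rr _ _ _]; exact: sphere3_le1.
have k_neq0 g x : bundle g setT x -> Num.sqrt (f (x.2 0 2)) != 0.
  by move=> /bt/f0 h; rewrite gt_eqF // sqrtr_gt0.
have kk g x : bundle g setT x -> Num.sqrt (f (x.2 0 2)) ^+ 2 = f (x.2 0 2).
  by move=> /bt/f0/ltW h; rewrite sqr_sqrtr.
have sfx g : smooth_on (bundle g setT) (fun x => f (x.2 0 2)).
  by apply: (smooth_on_comp (bt g) sf); smooth.
exists F, G; split.
- move=> x /[dup] /kk k2 /[dup] /k_neq0 k0 /[dup] /bt/f0 ft [].
  rewrite !dot3E => rr tr tt _; split => //=; rewrite ?dot3E ?vecE //=.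
    rewrite -(mul0r (Num.sqrt (f (x.2 0 2)))^-1) -tr; by field.
  rewrite [LHS](_ : _ = (x.1 0 0 * x.1 0 0 + x.1 0 1 * x.1 0 1 + x.1 0 2 * x.1 0 2)
     / Num.sqrt (f (x.2 0 2)) ^+ 2); last by field.
  by rewrite k2 tt divff // gt_eqF.
- move=> x /[dup] /kk k2 [].
  rewrite !dot3E => rr tr tt _; split => //=; rewrite ?dot3E ?vecE //=.
    rewrite -(mul0r (Num.sqrt (f (x.2 0 2)))) -tr; by ring.
  rewrite [LHS](_ : _ = (x.1 0 0 * x.1 0 0 + x.1 0 1 * x.1 0 1 + x.1 0 2 * x.1 0 2)
     * Num.sqrt (f (x.2 0 2)) ^+ 2); last by ring.
  by rewrite k2 tt mul1r.
- split=> [x /k_neq0|x /k_neq0] k0; rewrite /F /G [RHS]surjective_pairing [x.1 in RHS]vec3_eta /=;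
    rewrite !vecE /=; by congr (vec _ [:: _; _; _], _); field.
- rewrite /F; smooth => //; try exact: k_neq0; by move=> x /bt/f0.
- rewrite /G; smooth => //; by move=> x /bt/f0.
Qed.

(** The columns [tau], [r x tau], [r] form a rotation, whose unit quaternion [v] is determined up to
    sign. Working with [v^T *m v] avoids the choice of a sign, and both maps become polynomial. *)
Lemma bundle_RP3 : diffeomorphic (bundle (fun=> 1 : R) setT) (@RP3 R).
Proof.
pose q (x : 'rV[R]_3 * 'rV[R]_3) (i j : nat) := quaternion_proj (x.1 0 0) (x.2 0 1 * x.1 0 2 - x.2 0 2 * x.1 0 1) (x.2 0 0)
    (x.1 0 1) (x.2 0 2 * x.1 0 0 - x.2 0 0 * x.1 0 2) (x.2 0 1)
    (x.1 0 2) (x.2 0 0 * x.1 0 1 - x.2 0 1 * x.1 0 0) (x.2 0 2) i j.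
pose F (x : 'rV[R]_3 * 'rV[R]_3) : 'M[R]_4 := \matrix_(i, j) q x i j.
(* The first and third columns of the rotation of a unit quaternion [v], with each product
   [v_i * v_j] replaced by the entry [p i j]. *)
pose G (p : 'M[R]_4) : 'rV[R]_3 * 'rV[R]_3 :=
  (vec 3 [:: p 0 0 + p 1 1 - p 2 2 - p 3 3; 2 * (p 1 2 + p 0 3); 2 * (p 1 3 - p 0 2)],
   vec 3 [:: 2 * (p 1 3 + p 0 2); 2 * (p 2 3 - p 0 1); p 0 0 - p 1 1 - p 2 2 + p 3 3]).
have pE (v : 'rV[R]_4) i j : (v^T *m v) i j = v 0 i * v 0 j.
  by rewrite mxE big_ord1 !mxE.
have GB (v : 'rV[R]_4) : sphere v -> bundle (fun=> 1) setT (G (v^T *m v)).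
  rewrite /sphere /= dot4E => v1; split; rewrite //= ?dot3E /G /= !vecE /= !pE.
  - rewrite [LHS](_ : _ = (v 0 0 * v 0 0 + v 0 1 * v 0 1 + v 0 2 * v 0 2 + v 0 3 * v 0 3) ^+ 2); last by ring.
    by rewrite v1 expr1n.
  - by ring.
  - rewrite [LHS](_ : _ = (v 0 0 * v 0 0 + v 0 1 * v 0 1 + v 0 2 * v 0 2 + v 0 3 * v 0 3) ^+ 2); last by ring.
    by rewrite v1 expr1n.
exists F, G; split.
- move=> x [rr tr tt _]; rewrite !dot3E in rr tr tt.
  have qq i j k : (i < 4)%N -> (j < 4)%N -> (k < 4)%N -> q x i j * q x i k = q x i i * q x j k.
    by apply: quaternion_proj_rank1.
  have qtr : q x 0 0 + q x 1 1 + q x 2 2 + q x 3 3 = 1.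
    by rewrite /q /quaternion_proj /=; field.
  (* The trace is 1, so some diagonal entry is positive; dividing its row by the square root of that
     entry yields a vector [v], by the rank-one relations. *)
  have [i qi] : exists i : 'I_4, 0 < q x i i.
    have [//|H] := pselect (exists i : 'I_4, 0 < q x i i).
    have H' (i : 'I_4) : q x i i <= 0 by rewrite leNgt; apply/negP => h; apply: H; exists i.
    have := H' 0; have := H' 1; have := H' 2; have := H' 3; rewrite /= /inord /= => *.
    by exfalso; move: qtr; lra.
  have s0 : Num.sqrt (q x i i) != 0 by rewrite gt_eqF // sqrtr_gt0.
  have ss : Num.sqrt (q x i i) ^+ 2 = q x i i by rewrite sqr_sqrtr // ltW.
  have vv (j k : 'I_4) : q x i j / Num.sqrt (q x i i) * (q x i k / Num.sqrt (q x i i)) = q x j k.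
    rewrite [LHS](_ : _ = q x i j * q x i k / Num.sqrt (q x i i) ^+ 2); last by field.
    by rewrite ss qq // mulrAC divff ?mul1r // gt_eqF.
  exists (\row_j (q x i j / Num.sqrt (q x i i))).
    by rewrite /sphere /= dot4E !mxE !vv.
  by apply/matrixP => j k; rewrite pE !mxE vv.
- by move=> _ [v v1 <-]; exact: GB.
- split=> [x [rr tr tt _]|_ [v v1 <-]].
    rewrite [RHS]surjective_pairing [x.1 in RHS]vec3_eta [x.2 in RHS]vec3_eta.
    by rewrite /G /F !mxE /q /quaternion_proj /=; congr (vec _ [:: _; _; _], vec _ [:: _; _; _]); field.
  have v2 : v 0 0 * v 0 0 + v 0 1 * v 0 1 + v 0 2 * v 0 2 + v 0 3 * v 0 3 = 1 by rewrite -dot4E.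
  pose g := G (v^T *m v).
  (* Multiplying by the squared norm makes the right-hand sides below homogeneous of degree 4 like
     the left-hand sides, so that [ring] applies. *)
  have nn y : y * (v 0 0 * v 0 0 + v 0 1 * v 0 1 + v 0 2 * v 0 2 + v 0 3 * v 0 3) = y.
    by rewrite v2 mulr1.
  have M1 : g.2 0 1 * g.1 0 2 - g.2 0 2 * g.1 0 1 = 2 * (v 0 1 * v 0 2 - v 0 0 * v 0 3).
    by rewrite -[RHS](nn _) /g /G /= !vecE /= !pE; ring.
  have M2 : g.2 0 2 * g.1 0 0 - g.2 0 0 * g.1 0 2 =
      v 0 0 * v 0 0 - v 0 1 * v 0 1 + v 0 2 * v 0 2 - v 0 3 * v 0 3.
    by rewrite -[RHS](nn _) /g /G /= !vecE /= !pE; ring.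
  have M3 : g.2 0 0 * g.1 0 1 - g.2 0 1 * g.1 0 0 = 2 * (v 0 2 * v 0 3 + v 0 0 * v 0 1).
    by rewrite -[RHS](nn _) /g /G /= !vecE /= !pE; ring.
  apply/matrixP => i j; rewrite /F mxE pE -/g /q M1 M2 M3 /g /G /= !vecE /= !pE.
  clear -v2; rewrite [v]vec4_eta; move: v2.
  move: (v 0 0) (v 0 1) (v 0 2) (v 0 3) => a b c d v2; rewrite !vecE.
  case: i => -[|[|[|[|//]]]] i4; case: j => -[|[|[|[|//]]]] j4; rewrite /quaternion_proj /=; lra.
- rewrite /F; apply: smooth_on_mx => i j; rewrite /q /quaternion_proj.
  case: i => -[|[|[|[|//]]]] i4; case: j => -[|[|[|[|//]]]] j4 /=; smooth => //.
- rewrite /G; smooth.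
Qed.
End ProjectiveSpace.

(** * Simple zeros: isolation, finiteness, signs *)

Section Zeros.
Context {R : realType}.
Implicit Types (f g q : R -> R).

Definition unit_segment : set R := [set t | -1 <= t <= 1].

Lemma smooth_on_within_continuous (V W : normedModType R) (A : set V) (f : V -> W) :
  smooth_on A f -> {within A, continuous f}.
Proof.
move=> sf; apply/subspace_continuousP => x Ax.
have [U [F [Ux oU CF EF]]] := smooth_on_elim sf Ax.
change (f @ within A (nbhs x) --> f x); rewrite -(EF x Ux Ax).
have cF : {for x, continuous F}.
  by apply: differentiable_continuous; exact: (Ck_differentiable (CF 0%N) Ux).
apply: cvg_trans; last exact: (@cvg_within_filter _ _ F _ _ _ A cF).
apply: near_eq_cvg; rewrite near_withinE.
by near do apply: EF; apply: open_nbhs_nbhs.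
Unshelve. all: by end_near. Qed.

Lemma smooth_on_continuous_at (V W : normedModType R) (A : set V) (f : V -> W) (x : V) :
  A° x -> smooth_on A f -> {for x, continuous f}.
Proof.
move=> Ax /smooth_on_within_continuous/subspace_continuousP.
move=> /(_ _ (interior_subset Ax)).
by rewrite (within_interior Ax).
Qed.

Lemma interior_unit_segment c : -1 < c -> c < 1 -> unit_segment° c.
Proof.
move=> c1 c2; apply: (@filterS _ _ _ [set t | -1 < t < 1]).
  by move=> t /= /andP[t1 t2]; rewrite /unit_segment /= !ltW.
apply: open_nbhs_nbhs; split; last by rewrite /= c1 c2.
rewrite (_ : mkset _ = [set t | -1 < t] `&` [set t | t < 1]).
  by apply: openI; [exact: open_gt|exact: open_lt].
by apply/seteqP; split=> t /= => [/andP|[]] // -> ->.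
Qed.

Lemma nonzero_sign g x y : smooth_on unit_segment g -> -1 <= x -> x <= y -> y <= 1 ->
  (forall t, x <= t <= y -> g t != 0) -> (0 < g x) = (0 < g y).
Proof.
move=> sg x1 xy y1 g0.
have cg : {within `[x, y], continuous g}.
  apply: smooth_on_within_continuous; apply: smooth_on_subset sg => t /=.
  by rewrite in_itv /= /unit_segment /= => /andP[t1 t2]; apply/andP; split; lra.
have := @IVT R g x y 0 xy cg.
have gx : g x != 0 by apply: g0; rewrite lexx xy.
have gy : g y != 0 by apply: g0; rewrite lexx xy.
move=> H; apply/idP/idP => h; rewrite lt_neqAle eq_sym ?gx ?gy /= leNgt; apply/negP => h'.
  have [|c] := H.
    by rewrite ge_min le_max (ltW h) (ltW h') orbT.
  by rewrite in_itv => /g0 /eqP.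
have [|c] := H.
  by rewrite ge_min le_max (ltW h) (ltW h') orbT.
by rewrite in_itv => /g0 /eqP.
Qed.

(** The difference quotient of [f] at [c] is [g] itself, so continuity of [g] at [c] suffices. *)
Lemma derive_factor f g c : {for c, continuous g} -> (forall t, f t = (t - c) * g t) ->
  'D_1 f c = g c.
Proof.
move=> cg fg; apply: cvg_lim => //.
have sc : (fun h : R => h + c) @ (0 : R)^' --> c.
  apply: cvg_within_filter; rewrite -{2}[c]add0r.
  by apply: cvgD; [exact: cvg_id|exact: cvg_cst].
have H : g \o (fun h : R => h + c) @ (0 : R)^' --> g c by exact: (cvg_comp _ _ sc cg).
apply: cvg_trans H.
apply: near_eq_cvg; rewrite near_withinE; near=> h => h0.
by rewrite /= !fg subrr mul0r subr0 /GRing.scale /= mulr1 addrK mulKf.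
Unshelve. all: by end_near. Qed.

(** Zeros are kept off the ends, where ['D_1 f] would depend on values of [f] outside the
    segment. *)
Definition simple_zeros f :=
  forall c, -1 <= c <= 1 -> f c = 0 -> [/\ -1 < c, c < 1 & 'D_1 f c != 0].

Lemma smooth_on_near_neq0 g c : -1 <= c <= 1 -> smooth_on unit_segment g -> g c != 0 ->
  exists U : set R, [/\ open U, U c & forall t, unit_segment t -> U t -> g t != 0].
Proof.
move=> c1 sg gc.
have [U oU HU] := smooth_on_preimage_open sg (@open_neq R 0).
by exists U; split=> //; [apply/HU|move=> t It /HU; exact].
Qed.

Lemma isolated_zero f c : smooth_on unit_segment f -> simple_zeros f -> -1 <= c <= 1 ->
  exists U : set R, [/\ open U, U c & forall t, unit_segment t -> U t -> f t = 0 -> t = c].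
Proof.
move=> sf fs c1; have [fc|fc] := eqVneq (f c) 0; last first.
  have [U [oU Uc HU]] := smooth_on_near_neq0 c1 sf fc.
  by exists U; split=> // t It Ut /eqP; rewrite (negbTE (HU _ It Ut)).
have [c1' c2 Df] := fs _ c1 fc.
have [q [sq fq qc]] := smooth_on_factor (interior_unit_segment c1' c2) sf fc.
rewrite -qc in Df.
have [U [oU Uc HU]] := smooth_on_near_neq0 c1 sq Df.
exists U; split=> // t It Ut /eqP.
by rewrite fq mulf_eq0 (negbTE (HU _ It Ut)) orbF subr_eq0 => /eqP.
Qed.

(** By compactness the segment is covered by finitely many neighbourhoods, each with at most its
    centre as a zero. The list consists of the centres and may contain points that are not zeros. *)
Lemma finite_zeros f : smooth_on unit_segment f -> simple_zeros f ->
  exists s : seq R, forall t, -1 <= t <= 1 -> f t = 0 -> t \in s.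
Proof.
move=> sf fs.
have /choice [N HN] : forall c : R, exists U : set R, -1 <= c <= 1 ->
    [/\ open U, U c & forall t, unit_segment t -> U t -> f t = 0 -> t = c].
  move=> c; have [c1|c1] := boolP (-1 <= c <= 1); last by exists set0.
  by have [U HU] := isolated_zero sf fs c1; exists U.
have : compact (`[-1, 1]%classic : set R) by exact: segment_compact.
rewrite compact_cover => /(_ _ (`[-1, 1]%classic : set R) N) [].
- by move=> i /=; rewrite in_itv /= => /HN [].
- move=> t; rewrite /= in_itv /= => t1; exists t; first by rewrite /= in_itv.
  by have [] := HN _ t1.
move=> D' D1 D2; exists (finmap.enum_fset D') => t t1 ft.
have [|c /= cD Ut] := D2 t; first by rewrite /= in_itv.
have c1 : -1 <= c <= 1 by have := D1 _ cD; rewrite inE /= in_itv.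
have [_ _ H] := HN _ c1.
by rewrite (H t).
Qed.

(** Only an upper bound on the zeros: extra members are harmless, and the length of [s] serves as
    the measure of an induction. *)
Definition zeros_in f y (s : seq R) := forall t, -1 <= t <= y -> f t = 0 -> t \in s.

Lemma seq_max (s : seq R) z : z \in s ->
  exists2 c, c \in s & forall t, t \in s -> t <= c.
Proof.
elim: s z => // a s IH z _; case: s IH => [|b s] IH.
  by exists a; [rewrite mem_seq1|move=> t; rewrite mem_seq1 => /eqP ->].
have [c cs cmax] := IH b (mem_head _ _).
have [ac|ca] := leP a c.
  exists c; first by rewrite inE cs orbT.
  by move=> t; rewrite inE => /orP[/eqP ->|/cmax].
exists a; first exact: mem_head.
by move=> t; rewrite inE => /orP[/eqP -> //|/cmax tc]; apply: le_trans tc (ltW ca).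
Qed.

Lemma max_zero f y s t0 : zeros_in f y s -> -1 <= t0 <= y -> f t0 = 0 ->
  exists c, [/\ -1 <= c <= y, f c = 0 & forall t, c < t <= y -> f t != 0].
Proof.
move=> zs t01 ft0.
pose s' := [seq t <- s | (-1 <= t <= y) && (f t == 0)].
have zs' t : -1 <= t <= y -> f t = 0 -> t \in s'.
  by move=> t1 ft; rewrite mem_filter t1 ft eqxx /=; apply: zs.
have [c] := seq_max (zs' _ t01 ft0).
rewrite mem_filter => /andP[/andP[c1 /eqP fc] _] cmax.
exists c; split=> // t /andP[ct ty]; apply/eqP => ft.
have /cmax : t \in s'.
  by apply: zs' => //; rewrite ty andbT; have /andP[+ _] := c1; lra.
by rewrite leNgt ct.
Qed.

Lemma factor_simple_zero f c : smooth_on unit_segment f -> simple_zeros f ->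
  -1 <= c <= 1 -> f c = 0 ->
  exists q, [/\ smooth_on unit_segment q, forall t, f t = (t - c) * q t & q c != 0].
Proof.
move=> sf fs c1 fc; have [c1' c2 Df] := fs _ c1 fc.
have [q [sq fq qc]] := smooth_on_factor (interior_unit_segment c1' c2) sf fc.
by exists q; split=> //; rewrite qc.
Qed.

Lemma near_same_sign q c : -1 < c -> c < 1 -> smooth_on unit_segment q -> q c != 0 ->
  exists2 d, 0 < d & forall t, `|t - c| < d ->
    [/\ -1 <= t <= 1, q t != 0 & (0 < q t) = (0 < q c)].
Proof.
move=> c1 c2 sq qc.
have [U [oU Uc HU]] : exists U : set R, [/\ open U, U c & forall t, unit_segment t -> U t -> q t != 0].
  by apply: smooth_on_near_neq0 => //; rewrite !ltW.
have : nbhs c (U `&` unit_segment°).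
  by apply: filterI; [exact: open_nbhs_nbhs|apply: open_nbhs_nbhs; split;
    [exact: open_interior|exact: interior_unit_segment]].
move=> /nbhs_ballP [d /= d0 Hd]; exists d => // t td.
have H s : `|s - c| < d -> -1 <= s <= 1 /\ q s != 0.
  move=> sd; have [|Us /interior_subset Is] := Hd s.
    by rewrite -ball_normE /= distrC.
  by split=> //; exact: HU.
have [t1 qt] := H t td; split=> //.
have [tc|ct] := leP t c.
  apply: nonzero_sign => //; [by have /andP[] := t1|exact: ltW|].
  move=> s /andP[ts sc]; apply: (H s _).2.
  by move: td; rewrite distrC [in X in _ -> X]distrC !ger0_norm ?subr_ge0 //; lra.
apply/esym; apply: nonzero_sign => //; [exact: ltW|exact: ltW|by have /andP[] := t1|].
move=> s /andP[cs st]; apply: (H s _).2.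
by move: td; rewrite !ger0_norm ?subr_ge0 //; lra.
Qed.

End Zeros.

(** * Components cut out by windows of heights *)

Section Bands.
Context {R : realType}.
Implicit Types (f g q : R -> R) (D : set R).

Lemma unit_segment_sub (b c : R) : -1 <= b -> c <= 1 ->
  [set t : R | b <= t <= c] `<=` unit_segment.
Proof. by move=> b1 c1 t /= /andP[bt tc]; apply/andP; split; lra. Qed.

Lemma nonzero_gt0 q x y m : smooth_on unit_segment q -> -1 <= x -> y <= 1 ->
  x <= m <= y -> 0 < q m -> (forall t, x <= t <= y -> q t != 0) ->
  forall t, x <= t <= y -> 0 < q t.
Proof.
move=> sq x1 y1 /andP[xm my] qm q0 t /andP[xt ty].
have [tm|mt] := leP t m.
  rewrite (nonzero_sign sq _ tm) //; [lra|lra|].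
  by move=> s /andP[ts sm]; apply: q0; apply/andP; split; lra.
rewrite -(nonzero_sign sq _ (ltW mt)) //; [lra|lra|].
by move=> s /andP[ts sm]; apply: q0; apply/andP; split; lra.
Qed.

(** [D] is a window of heights in which [f] is nonnegative on the band only. Dividing at [b] and
    then at [c] gives [f = (t - b) * (c - t) * q]; simplicity of both zeros makes [q] nonzero at the
    ends, and the midpoint decides its sign. *)
Lemma band_piece f D b c : smooth_on unit_segment f -> simple_zeros f ->
  -1 < b -> b < c -> c < 1 -> f b = 0 -> f c = 0 -> (forall t, b < t < c -> 0 < f t) ->
  (forall t, D t -> -1 < t) -> (forall t, D t -> 0 <= f t -> b <= t <= c) ->
  (forall t, b <= t <= c -> D t) ->
  diffeomorphic (bundle f D) (@S1xS2 R).
Proof.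
move=> sf fs b1 bc c1 fb fc fpos D1 Dbc bcD.
have c11 : -1 <= c <= 1 by apply/andP; split; lra.
have b11 : -1 <= b <= 1 by apply/andP; split; lra.
have [q1 [sq1 fq1 q1b]] := factor_simple_zero sf fs b11 fb.
have cI : unit_segment° c by apply: interior_unit_segment => //; lra.
have q1c : q1 c = 0.
  by move/eqP: fc; rewrite fq1 mulf_eq0 subr_eq0 gt_eqF //= => /eqP.
have [q2 [sq2 q12 _]] := smooth_on_factor cI sq1 q1c.
have fq t : f t = (t - b) * (c - t) * - q2 t by rewrite fq1 q12; ring.
have sg : smooth_on unit_segment (fun t => (t - b) * q2 t) by smooth.
have Df : 'D_1 f c = (c - b) * q2 c.
  apply: (derive_factor (smooth_on_continuous_at cI sg)) => t.
  by rewrite fq1 q12; ring.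
have q2c : q2 c != 0.
  by have [_ _] := fs c c11 fc; rewrite Df mulf_eq0 negb_or => /andP[].
have q2b : q2 b != 0.
  by move: q1b; rewrite q12 mulf_eq0 negb_or => /andP[].
have q20 t : b <= t <= c -> - q2 t != 0.
  rewrite oppr_eq0 => /andP[bt tc].
  have [->//|tb] := eqVneq t b; have [->//|tc'] := eqVneq t c.
  apply/eqP => q2t; have : 0 < f t by apply: fpos; rewrite !lt_neqAle bt tc tc' eq_sym tb.
  by rewrite fq q2t oppr0 mulr0 ltxx.
have q2m : 0 < - q2 ((b + c) / 2).
  have : 0 < f ((b + c) / 2) by apply: fpos; apply/andP; split; lra.
  have h1 : 0 < (b + c) / 2 - b by lra.
  have h2 : 0 < c - (b + c) / 2 by lra.
  by rewrite fq pmulr_rgt0 // mulr_gt0.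
have qpos : forall t, b <= t <= c -> 0 < - q2 t.
  apply: (@nonzero_gt0 (fun t => - q2 t) _ _ _ _ _ _ _ q2m q20); [by smooth|lra|lra|].
  by apply/andP; split; lra.
apply: (diffeomorphic_trans (@bundle_chart _ f D D1)).
apply: (@chart_band R f (fun t => - q2 t) D b c) => //.
by smooth; apply: smooth_on_subset sq2; apply: unit_segment_sub; lra.
Qed.

(** One division at [c] is enough, since the other end is the pole; the value at the pole decides
    the sign of the quotient. *)
Lemma cap_piece f D c : smooth_on unit_segment f -> simple_zeros f ->
  -1 < c -> c < 1 -> f c = 0 -> (forall t, c < t <= 1 -> 0 < f t) ->
  (forall t, D t -> -1 < t) -> (forall t, D t -> 0 <= f t -> c <= t) ->
  (forall t, c <= t <= 1 -> D t) ->
  diffeomorphic (bundle f D) (@sphere R 3).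
Proof.
move=> sf fs c1 c2 fc fpos D1 Dc cD.
have c11 : -1 <= c <= 1 by apply/andP; split; lra.
have [q [sq fq qc]] := factor_simple_zero sf fs c11 fc.
have q0 t : c <= t <= 1 -> q t != 0.
  move=> /andP[ct t1]; have [->//|tc] := eqVneq t c.
  apply/eqP => qt; have : 0 < f t by apply: fpos; rewrite lt_neqAle eq_sym tc ct.
  by rewrite fq qt mulr0 ltxx.
have q1 : 0 < q 1.
  have : 0 < f 1 by apply: fpos; apply/andP; split; lra.
  by rewrite fq pmulr_rgt0 // subr_gt0.
have qpos : forall t, c <= t <= 1 -> 0 < q t.
  apply: (nonzero_gt0 sq _ _ _ q1 q0); [lra|lra|].
  by apply/andP; split; lra.
apply: (diffeomorphic_trans (@bundle_chart _ f D D1)).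
apply: (@chart_cap R f q D c) => //.
by apply: smooth_on_subset sq; apply: unit_segment_sub; lra.
Qed.

Lemma unit_segmentN (t : R) : unit_segment t -> unit_segment (- t).
Proof. by move=> /andP[t1 t2]; apply/andP; split; lra. Qed.

Lemma smooth_on_mirror f : smooth_on unit_segment f ->
  smooth_on unit_segment (fun t => f (- t)).
Proof. by move=> sf; apply: (smooth_on_comp unit_segmentN sf); smooth. Qed.

Lemma simple_zeros_mirror f : smooth_on unit_segment f -> simple_zeros f ->
  simple_zeros (fun t => f (- t)).
Proof.
move=> sf fs c c1 fc; have [h1 h2 Df] := fs (- c) (unit_segmentN c1) fc.
have cI : unit_segment° c by apply: interior_unit_segment; lra.
split; [lra|lra|].
have [q [sq fq qc]] := factor_simple_zero sf fs (unit_segmentN c1) fc.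
have sg : smooth_on unit_segment (fun t => - q (- t)) by smooth; exact: smooth_on_mirror.
rewrite (derive_factor (smooth_on_continuous_at cI sg)) ?oppr_eq0 // => t.
by rewrite fq; ring.
Qed.

Lemma open_height_lt (y : R) : open [set x : 'rV[R]_3 * 'rV[R]_3 | x.2 0 2 < y].
Proof.
have ch : continuous (fun x : 'rV[R]_3 * 'rV[R]_3 => x.2 0 2).
  move=> x; apply: (@continuous_comp _ _ _ (@snd _ _) (fun v : 'rV[R]_3 => v 0 2)).
    exact: snd_continuous.
  exact: coord_continuous.
by have /continuousP/(_ _ (@open_lt R y)) := ch.
Qed.

Lemma open_height_gt (y : R) : open [set x : 'rV[R]_3 * 'rV[R]_3 | y < x.2 0 2].
Proof.
have ch : continuous (fun x : 'rV[R]_3 * 'rV[R]_3 => x.2 0 2).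
  move=> x; apply: (@continuous_comp _ _ _ (@snd _ _) (fun v : 'rV[R]_3 => v 0 2)).
    exact: snd_continuous.
  exact: coord_continuous.
by have /continuousP/(_ _ (@open_gt R y)) := ch.
Qed.

Lemma bundle_ge0 f D x : bundle f D x -> 0 <= f (x.2 0 2).
Proof.
move=> [_ _ <- _]; rewrite dot3E.
by rewrite !addr_ge0 // -expr2 sqr_ge0.
Qed.

(** The fiber over [y] is empty, so the parts below and above this height are both open in the
    bundle. *)
Lemma bundle_split f D y k1 l1 k2 l2 : f y < 0 -> (forall t, t < y -> D t) ->
  disjoint_union_S1xS2_S3 k1 l1 (bundle f [set t | t < y]) ->
  disjoint_union_S1xS2_S3 k2 l2 (bundle f [set t | D t /\ y < t]) ->
  disjoint_union_S1xS2_S3 (k1 + k2) (l1 + l2) (bundle f D).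
Proof.
move=> fy yD u1 u2.
apply: (@disjoint_unionU R ('rV[R]_3 * 'rV[R]_3)%type _ _ _ _ _ _ _
  (@open_height_lt y) (@open_height_gt y)).
- move=> x /bundle_ge0 fx; have [xy|yx|xy] := ltgtP (x.2 0 2) y.
  + by left.
  + by right.
  + by move: fx; rewrite xy leNgt fy.
- by apply/seteqP; split=> x //= [[_ xy]]; rewrite ltNge ltW.
- rewrite (_ : _ `&` _ = bundle f [set t | t < y]) //.
  by apply/seteqP; split=> x => [[[? ? ? ?] ?]|[? ? ? xy]]; split => //; split => //; exact: yD.
- rewrite (_ : _ `&` _ = bundle f [set t | D t /\ y < t]) //.
  by apply/seteqP; split=> x => [[[? ? ? ?] ?]|[? ? ? [? ?]]].
Qed.

(** Near [c] the function is [t - c] times a factor of constant sign; [up] says that this factor is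
    positive. *)
Lemma zero_crossing f c : smooth_on unit_segment f -> simple_zeros f ->
  -1 <= c <= 1 -> f c = 0 ->
  exists (up : bool) (d : R), 0 < d /\ forall t, `|t - c| < d -> t != c ->
    [/\ -1 <= t <= 1, f t != 0 & (0 < f t) = ((c < t) == up)].
Proof.
move=> sf fs c11 fc.
have [c1 c2 _] := fs c c11 fc.
have [q [sq fq qc]] := factor_simple_zero sf fs c11 fc.
have [d d0 Hd] := near_same_sign c1 c2 sq qc.
exists (0 < q c), d; split=> // t /Hd [t1 qt <-] tc.
split=> //; first by rewrite fq mulf_neq0 // subr_eq0.
rewrite fq; have [ct|tc'|ct] := ltgtP c t.
- by rewrite pmulr_rgt0 ?subr_gt0.
- rewrite nmulr_rgt0 ?subr_lt0 //.
  by rewrite eq_sym eqbF_neg -leNgt le_eqVlt (negbTE qt).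
- by rewrite ct eqxx in tc.
Qed.

End Bands.

(** * Classification of the circle bundle *)

Section Classification.
Context {R : realType}.
Implicit Types (f g q : R -> R) (D : set R).

(** The sign changes at a simple zero, so the side above [c] determines the side below. *)
Lemma sign_left_of_zero f c y (pos : bool) : smooth_on unit_segment f -> simple_zeros f ->
  -1 <= c <= 1 -> f c = 0 -> c < y -> (forall t, c < t < y -> (0 < f t) = pos) ->
  exists c', [/\ -1 < c', c' < c
    & forall t, c' <= t -> t < c -> f t != 0 /\ (0 < f t) = ~~ pos].
Proof.
move=> sf fs c11 fc cy fpos.
have [up [d [d0 Hd]]] := zero_crossing sf fs c11 fc.
have upE : up = pos.
  (* The height [c + m] lies both in the range of the crossing and below [y]; comparing the two
     descriptions of the sign there determines [up]. *)
  pose m := Num.min (d / 2) ((y - c) / 2).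
  have m0 : 0 < m by rewrite lt_min; apply/andP; split; lra.
  have md : m <= d / 2 by rewrite ge_min lexx.
  have my : m <= (y - c) / 2 by rewrite ge_min lexx orbT.
  have [||_ _] := Hd (c + m).
  - by rewrite addrAC subrr add0r gtr0_norm //; lra.
  - by rewrite gt_eqF //; lra.
  rewrite fpos; last by apply/andP; split; lra.
  by rewrite ltrDl m0 => ->; case: up {Hd}.
have near t : c - d < t -> t < c -> [/\ -1 <= t, f t != 0 & (0 < f t) = ~~ pos].
  move=> dt tc; have [||/andP[t1 _] ft ->] := Hd t.
  - by rewrite distrC gtr0_norm; lra.
  - by rewrite lt_eqF.
  by rewrite lt_gtF // upE.
exists (c - d / 2); split; last by move=> t ct tc; have [||_ ? ?] := near t; [lra|lra|split].
(* The auxiliary height [c - 3 / 4 * d] lies strictly below [c - d / 2] and is still at least -1,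
   which makes the bound on [c'] strict. *)
- by have [||h1 _ _] := near (c - 3 / 4 * d); [lra|lra|lra].
- by lra.
Qed.

Lemma no_zero_lt0 f x y : smooth_on unit_segment f -> -1 <= x -> x <= y -> y <= 1 ->
  (forall t, x <= t <= y -> f t != 0) -> f y < 0 -> f x < 0.
Proof.
move=> sf x1 xy y1 f0 fy.
have := nonzero_sign sf x1 xy y1 f0; rewrite (lt_gtF fy) => /negbT.
by rewrite -leNgt le_eqVlt (negbTE (f0 x _)) // lexx.
Qed.

Lemma not_pos_lt0 (x : R) : x != 0 -> (0 < x) = false -> x < 0.
Proof. by move=> x0 /negbT; rewrite -leNgt le_eqVlt (negbTE x0). Qed.

Lemma lower_cap f c y : smooth_on unit_segment f -> simple_zeros f ->
  -1 < c -> c < 1 -> y <= 1 -> c < y -> f c = 0 ->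
  (forall t, -1 <= t -> t < c -> 0 < f t) -> (forall t, c < t <= y -> f t < 0) ->
  diffeomorphic (bundle f [set t | t < y]) (@sphere R 3).
Proof.
move=> sf fs c1 c2 y1 cy fc fpos fneg.
apply: diffeomorphic_trans (@bundle_mirror R f [set t | t < y]) _.
apply: (@cap_piece R (fun t => f (- t)) _ (- c)); [| |lra|lra| | | | |].
- exact: smooth_on_mirror.
- exact: simple_zeros_mirror.
- by rewrite opprK.
- by move=> t /andP[ct t1']; apply: fpos; lra.
- by move=> t /= ty; lra.
- move=> t /= ty ft; rewrite leNgt; apply/negP => tc.
  by move: ft; rewrite leNgt fneg //; apply/andP; split; lra.
- by move=> t /andP[ct t1'] /=; lra.
Qed.

(** Descent from a height where [f] is negative. Below the largest zero [c] the function is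
    positive, either down to the south pole, which gives one S^3 and ends the descent, or down to a
    next zero [b], which gives one S^1 x S^2 and leads to a negative height below [b]. Hence S^3
    occurs at most once. *)
Lemma lower_part f n : smooth_on unit_segment f -> simple_zeros f ->
  forall y s, (size s <= n)%N -> -1 < y -> y <= 1 -> f y < 0 -> zeros_in f y s ->
  exists k l, (l <= 1)%N /\ disjoint_union_S1xS2_S3 k l (bundle f [set t | t < y]).
Proof.
move=> sf fs; elim: n => [|n IH] y s sn y1 y2 fy zs.
  have s0 : s = [::] by case: s sn {zs}.
  exists 0%N, 0%N; split=> //.
  rewrite (_ : bundle _ _ = set0); first exact: disjoint_union_set0.
  apply/seteqP; split=> // x /[dup] /bundle_ge0 fx [rr _ _ /= xy].
  have /andP[x1 _] := sphere3_le1 rr.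
  suff : f (x.2 0 2) < 0 by rewrite ltNge fx.
  apply: (no_zero_lt0 sf x1 (ltW xy) y2 _ fy) => t /andP[xt ty]; apply/eqP => ft.
  have : t \in s by apply: zs => //; rewrite ty (le_trans x1 xt).
  by rewrite s0.
have [[t0 [t01 ft0]]|noz] := pselect (exists t, -1 <= t <= y /\ f t = 0); last first.
  apply: (IH y [::]) => // t t1 ft; exfalso; apply: noz; by exists t.
have [c [/andP[c1 cy] fc cmax]] := max_zero zs t01 ft0.
have c11 : -1 <= c <= 1 by rewrite c1 (le_trans cy y2).
have [c1' c2 _] := fs c c11 fc.
have cy' : c < y by rewrite lt_neqAle cy andbT; apply/eqP => E; move: fy; rewrite -E fc ltxx.
have fneg t : c < t <= y -> f t < 0.
  move=> /andP[ct ty]; apply: (no_zero_lt0 sf (le_trans c1 (ltW ct)) ty y2 _ fy).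
  by move=> s' /andP[ts sy]; apply: cmax; rewrite sy (lt_le_trans ct ts).
clear t0 t01 ft0 cmax.
(* [c'] separates [c] from the zeros below it, so that the next largest zero can be sought on the
   closed range up to [c']. *)
have [|c' [c'1 c'c fleft]] := sign_left_of_zero (y := y) (pos := false) sf fs c11 fc cy'.
  by move=> t /andP[ct ty]; apply: lt_gtF; apply: fneg; rewrite ct ltW.
have fc'c t : c' <= t -> t < c -> 0 < f t by move=> h1 h2; rewrite (fleft t h1 h2).2.
have zs' : zeros_in f c' s.
  move=> t /andP[t1 tc'] ft; apply: zs => //; rewrite t1.
  exact: (le_trans tc' (ltW (lt_trans c'c cy'))).
have cs : c \in s by apply: zs => //; rewrite c1 cy.
have fspread b : -1 <= b -> (forall t, b <= t <= c' -> f t != 0) -> 0 < f b \/ c' < b.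
  move=> b1 bz; have [bc|] := leP b c'; last by right.
  left; rewrite (nonzero_sign sf b1 bc _ bz) ?fc'c //.
  exact: (le_trans (ltW c'c) (ltW c2)).
(* Without a further zero the positive region reaches the south pole and forms a cap. *)
have [[t1 [t11 ft1]]|noz] := pselect (exists t, -1 <= t <= c' /\ f t = 0); last first.
  exists 0%N, 1%N; split=> //; apply: disjoint_union_S3; apply: (@lower_cap f c) => //.
  move=> t t1 tc; have [||c't] := fspread t t1 => //.
    move=> s' /andP[ts sc]; apply/eqP => fs'; apply: noz; exists s'; split=> //.
    by rewrite (le_trans t1 ts).
  exact: fc'c (ltW c't) tc.
have [b [/andP[b1 bc'] fb bmax]] := max_zero zs' t11 ft1.
have bc : b < c by exact: le_lt_trans bc' c'c.
have b11 : -1 <= b <= 1 by rewrite b1 (ltW (lt_trans bc c2)).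
have [b1' _ _] := fs b b11 fb.
have fbc t : b < t < c -> 0 < f t.
  move=> /andP[bt tc]; have [||c't] := fspread t (le_trans b1 (ltW bt)) => //.
    by move=> s' /andP[ts sc]; apply: bmax; rewrite sc (lt_le_trans bt ts).
  exact: fc'c (ltW c't) tc.
(* The negative height [y'] just below [b] takes over the role of [y]. *)
have [|y' [y'1 y'b yleft]] := sign_left_of_zero (y := c) (pos := true) sf fs b11 fb bc.
  by move=> t /fbc ->.
have yneg t : y' <= t -> t < b -> f t < 0.
  by move=> h1 h2; have [ft /not_pos_lt0] := yleft t h1 h2; apply.
have fy' : f y' < 0 by apply: yneg.
have y'c := lt_trans y'b bc.
(* The zero [c] lies above [y'] and can leave the list, which lowers the measure of the
   induction. *)
have zy' : zeros_in f y' (rem c s).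
  move=> t /andP[t1' ty'] ft; apply: rem_mem; first by rewrite lt_eqF // (le_lt_trans ty').
  by apply: zs => //; rewrite t1' (le_trans ty') // (ltW (lt_trans y'c cy')).
have sz : (size (rem c s) <= n)%N.
  by rewrite size_rem //; case: (s) sn cs.
have [|k [l [l1 u]]] := IH y' _ sz y'1 _ fy' zy'; first exact: ltW (lt_trans y'c c2).
exists (k + 1)%N, (l + 0)%N; split; first by rewrite addn0.
apply: (bundle_split fy' _ u).
  by move=> t /= ty'; exact: (lt_trans ty' (lt_trans y'c cy')).
apply: disjoint_union_S1xS2; apply: (@band_piece R f _ b c) => //.
- by move=> t /= [_ y't]; exact: lt_trans y'1 y't.
- move=> t /= [ty y't] ft; apply/andP; split; rewrite leNgt; apply/negP => h.
    by move: ft; rewrite leNgt yneg // ltW.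
  by move: ft; rewrite leNgt fneg // h ltW.
- move=> t /andP[bt tc] /=; split; first exact: le_lt_trans tc cy'.
  exact: lt_le_trans y'b bt.
Qed.

(** The sign at the north pole decides: if negative, the descent starts at height 1; if positive
    without zeros, the bundle is RP^3; otherwise a cap around the north pole adds one S^3 to the at
    most one found below it. *)
Lemma bundle_classification f : smooth_on unit_segment f -> simple_zeros f ->
  diffeomorphic (bundle f setT) (@RP3 R) \/
  exists k l : nat, (l <= 2)%N /\ disjoint_union_S1xS2_S3 k l (bundle f setT).
Proof.
move=> sf fs; have [s Hs] := finite_zeros sf fs.
have f1 : f 1 != 0.
  apply/eqP => f10; have h : -1 <= (1 : R) <= 1 by apply/andP; split; lra.
  by have [_] := fs 1 h f10; rewrite ltxx.
have [f1n|f1p] : f 1 < 0 \/ 0 < f 1 by move: f1; rewrite neq_lt => /orP.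
  right; have [|k [l [l1 u]]] := lower_part sf fs (leqnn _) _ (lexx 1) f1n Hs; first by lra.
  exists k, l; split; first by rewrite ltnW.
  rewrite (_ : bundle f setT = bundle f [set t | t < 1]) //.
  apply/seteqP; split=> x /[dup] /bundle_ge0 fx [rr tr tt _]; split=> //=.
  have /andP[_ x1] := sphere3_le1 rr; rewrite lt_neqAle x1 andbT.
  by apply/eqP => E; move: fx; rewrite E leNgt f1n.
have [[t0 [t01 ft0]]|noz] := pselect (exists t, -1 <= t <= 1 /\ f t = 0); last first.
  left; apply: diffeomorphic_trans bundle_RP3.
  apply: bundle_scale => // t /andP[t1 t2].
  rewrite (nonzero_sign sf t1 t2) // => s' /andP[ts s1].
  by apply/eqP => fs'; apply: noz; exists s'; split=> //; rewrite (le_trans t1 ts).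
right.
have [c [c11 fc cmax]] := max_zero Hs t01 ft0.
have [c1 c2 _] := fs c c11 fc.
have fpos t : c < t <= 1 -> 0 < f t.
  move=> /andP[ct t1]; rewrite (nonzero_sign sf (ltW (lt_trans c1 ct)) t1) //.
  by move=> s' /andP[ts s1]; apply: cmax; rewrite s1 (lt_le_trans ct ts).
have [|y' [y'1 y'c yleft]] := sign_left_of_zero (y := 1) (pos := true) sf fs c11 fc c2.
  by move=> t /andP[ct t1]; apply: fpos; rewrite ct ltW.
have yneg t : y' <= t -> t < c -> f t < 0.
  by move=> h1 h2; have [ft /not_pos_lt0] := yleft t h1 h2; apply.
have fy' : f y' < 0 by apply: yneg.
have zy' : zeros_in f y' s.
  move=> t /andP[t1' ty'] ft; apply: Hs => //.
  by rewrite t1' (le_trans ty') // (ltW (lt_trans y'c c2)).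
have [|k [l [l1 u]]] := lower_part sf fs (leqnn _) y'1 _ fy' zy'.
  exact: ltW (lt_trans y'c c2).
exists (k + 0)%N, (l + 1)%N; split; first by rewrite addn1.
apply: (bundle_split fy' _ u) => //.
apply: disjoint_union_S3; apply: (@cap_piece R f _ c) => //.
- by move=> t /= [_ y't]; exact: lt_trans y'1 y't.
- move=> t /= [_ y't] ft; rewrite leNgt; apply/negP => h.
  by move: ft; rewrite leNgt yneg // ltW.
- by move=> t /andP[ct t1] /=; split=> //; exact: lt_le_trans y'c ct.
Qed.

End Classification.

(** * Reduction of the energy level to the circle bundle *)

Section Reduction.
Context {R : realType} (a g beta : R) (g1 g2 g3 V : R * R -> R) (h : R).
Context (a_gt0 : 0 < a) (beta_gt0 : 0 < beta).
Context (sg1 : smooth_on (@coef_domain R) g1) (sg2 : smooth_on (@coef_domain R) g2)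
  (sg3 : smooth_on (@coef_domain R) g3) (sV : smooth_on (@coef_domain R) V).

(** The squared length of [(R_1, R_2, sqrt beta * R_3)] on the sphere [R^2 = a] at [R_3 = z]. *)
Definition ellipsoid_sqnorm (z : R) := a - z ^+ 2 + beta * z ^+ 2.

Definition shifted_momentum (z : R) := g + beta * g3 (a, z) * z.

(** The minimum of [H] over the fiber of the leaf at height [z]; the last term is the contribution
    of the component of the shifted momentum vector along the normal of the fiber plane. *)
Definition effective_potential (z : R) :=
  g2 (a, z) * g + V (a, z) - g1 (a, z) ^+ 2 * (a - z ^+ 2) / 2
  - beta * g3 (a, z) ^+ 2 / 2
  + shifted_momentum z ^+ 2 / (2 * ellipsoid_sqnorm z).

Definition height_weight (t : R) := beta * (1 - t ^+ 2) + t ^+ 2.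

(** The inverse of [z |-> sqrt beta * z / sqrt (ellipsoid_sqnorm z)]: it recovers [R_3] from the
    third coordinate [t] of the normalised vector. *)
Definition height (t : R) := Num.sqrt a * t / Num.sqrt (height_weight t).

Definition fiber_sqradius (t : R) := 2 * (h - effective_potential (height t)).

Let s := Num.sqrt beta.
Let A := Num.sqrt a.
Let s0 : s != 0. Proof. by rewrite gt_eqF // sqrtr_gt0. Qed.
Let A0 : A != 0. Proof. by rewrite gt_eqF // sqrtr_gt0. Qed.
Let ss : beta = s ^+ 2. Proof. by rewrite sqr_sqrtr // ltW. Qed.
Let AA : a = A ^+ 2. Proof. by rewrite sqr_sqrtr // ltW. Qed.

Lemma height_weight_gt0 t : unit_segment t -> 0 < height_weight t.
Proof.
move=> /andP[t1 t2]; rewrite /height_weight.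
have [->|t0] := eqVneq t 0; first by rewrite expr0n /= subr0 mulr1 addr0.
have : 0 < t ^+ 2 by rewrite exprn_even_gt0.
have : 0 <= 1 - t ^+ 2 by nra.
by move=> h1 h2; rewrite ltr_wpDl // mulr_ge0 // ltW.
Qed.

Lemma height_coef_domain t : unit_segment t -> coef_domain (a, height t).
Proof.
move=> t1; split=> //=; have w0 := height_weight_gt0 t1.
have w0' := ltW w0; have a0' := ltW a_gt0.
rewrite /height !exprMn exprVn !sqr_sqrtr // ler_pdivrMr // ler_pM2l //.
by rewrite /height_weight lerDr mulr_ge0 ?(ltW beta_gt0) //; move: t1 => /andP[]; nra.
Qed.

Lemma ellipsoid_sqnorm_gt0 z : coef_domain (a, z) -> 0 < ellipsoid_sqnorm z.
Proof.
move=> [_ /= za]; rewrite /ellipsoid_sqnorm.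
have [->|z0] := eqVneq z 0; first by rewrite expr0n /= mulr0 addr0 subr0.
have : 0 < z ^+ 2 by rewrite exprn_even_gt0.
by move=> zz; rewrite ltr_wpDl ?subr_ge0 // mulr_gt0.
Qed.

Lemma smooth_on_effective_potential :
  smooth_on [set z | coef_domain (a, z)] effective_potential.
Proof.
have sc (k : R * R -> R) : smooth_on (@coef_domain R) k ->
    smooth_on [set z | coef_domain (a, z)] (fun z => k (a, z)).
  by move=> sk; apply: (@smooth_on_comp _ _ _ _ _ _ _ _ (fun z : R => (a, z)) k _ sk) => //; smooth.
rewrite /effective_potential /shifted_momentum /ellipsoid_sqnorm.
smooth; try exact: sc.
by move=> z /ellipsoid_sqnorm_gt0 z0; rewrite mulf_neq0 // gt_eqF.
Qed.

Lemma smooth_on_height : smooth_on unit_segment height.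
Proof.
rewrite /height /height_weight; smooth => t /height_weight_gt0 t0 //.
by rewrite gt_eqF // sqrtr_gt0.
Qed.

Lemma smooth_on_fiber_sqradius : smooth_on unit_segment fiber_sqradius.
Proof.
rewrite /fiber_sqradius; apply: smooth_onM; first exact: smooth_on_cst.
apply: smooth_onD; first exact: smooth_on_cst.
apply: smooth_onN.
by apply: (@smooth_on_comp _ _ _ _ _ _ _ [set z | coef_domain (a, z)] height
  effective_potential height_coef_domain smooth_on_effective_potential smooth_on_height).
Qed.

Local Notation H := (hamiltonian beta g1 g2 g3 V).

(* Put [s = sqrt beta], [T = (S1 + g1 R2, S2 - g1 R1, (S3 + beta g3) / s)] and
   [N = (R1, R2, s R3)]. Then [2 H - T^2] depends on the Casimirs and on [R3] only,
   and [<T, N>] is the shifted momentum; [to_bundle] sends [(S, R)] to the part of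
   [T] orthogonal to [N], and to [N / |N|]. *)
Definition to_bundle (x : 'rV[R]_3 * 'rV[R]_3) : 'rV[R]_3 * 'rV[R]_3 :=
  let z := x.2 0 2 in
  let n := Num.sqrt (ellipsoid_sqnorm z) in
  let c := shifted_momentum z / ellipsoid_sqnorm z in
  (vec 3 [:: x.1 0 0 + g1 (a, z) * x.2 0 1 - c * x.2 0 0;
             x.1 0 1 - g1 (a, z) * x.2 0 0 - c * x.2 0 1;
             (x.1 0 2 + beta * g3 (a, z)) / s - c * s * z],
   vec 3 [:: x.2 0 0 / n; x.2 0 1 / n; s * z / n]).

(** Here [A * s / w] is the length of [N], so [N] is that multiple of [r], and [T] is [tau] plus [c]
    times [r] with [c] the shifted momentum divided by this length. The completed squares are then
    undone. *)
Definition of_bundle (y : 'rV[R]_3 * 'rV[R]_3) : 'rV[R]_3 * 'rV[R]_3 :=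
  let w := Num.sqrt (height_weight (y.2 0 2)) in
  let z := height (y.2 0 2) in
  let c := shifted_momentum z * w / (A * s) in
  (vec 3 [:: y.1 0 0 + c * y.2 0 0 - g1 (a, z) * (A * s * y.2 0 1 / w);
             y.1 0 1 + c * y.2 0 1 + g1 (a, z) * (A * s * y.2 0 0 / w);
             s * (y.1 0 2 + c * y.2 0 2) - beta * g3 (a, z)],
   vec 3 [:: A * s * y.2 0 0 / w; A * s * y.2 0 1 / w; z]).

Lemma leaf_coef_domain x : leaf a g x -> coef_domain (a, x.2 0 2).
Proof.
move=> [c1 _]; split=> //=; move: c1; rewrite /casimir1 dot3E.
have := sqr_ge0 (x.2 0 0); have := sqr_ge0 (x.2 0 1); rewrite !expr2; lra.
Qed.

Lemma bundle_unit_segment f (D : set R) (y : 'rV[R]_3 * 'rV[R]_3) :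
  bundle f D y -> unit_segment (y.2 0 2).
Proof. by move=> [rr _ _ _]; exact: sphere3_le1. Qed.

Lemma height_to_bundle x : leaf a g x ->
  Num.sqrt (height_weight ((to_bundle x).2 0 2)) =
    A * s / Num.sqrt (ellipsoid_sqnorm (x.2 0 2)) /\
  height ((to_bundle x).2 0 2) = x.2 0 2.
Proof.
move=> xl; have n0 := ellipsoid_sqnorm_gt0 (leaf_coef_domain xl).
have n_neq0 : Num.sqrt (ellipsoid_sqnorm (x.2 0 2)) != 0 by rewrite gt_eqF // sqrtr_gt0.
have W : Num.sqrt (height_weight ((to_bundle x).2 0 2)) =
    A * s / Num.sqrt (ellipsoid_sqnorm (x.2 0 2)).
  rewrite -[RHS]ger0_norm; last by rewrite divr_ge0 ?mulr_ge0 ?sqrtr_ge0.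
  rewrite -sqrtr_sqr; congr Num.sqrt.
  have n0' := ltW n0; rewrite /to_bundle /= vecE /= /height_weight !exprMn !exprVn -ss -AA sqr_sqrtr //.
  have n_neq0' : ellipsoid_sqnorm (x.2 0 2) != 0 by rewrite gt_eqF.
  apply: (mulIf n_neq0'); rewrite divfK //.
  rewrite [LHS](_ : _ = beta * ellipsoid_sqnorm (x.2 0 2) + (1 - beta) * beta * x.2 0 2 ^+ 2); last by field.
  by rewrite /ellipsoid_sqnorm; ring.
split=> //; rewrite /height W /to_bundle /= vecE /= -/A; field.
by rewrite A0 n_neq0 s0.
Qed.

Lemma to_bundleP x : level a g H h x -> bundle fiber_sqradius setT (to_bundle x).
Proof.
move=> [/[dup] xl [c1 c2] Hx]; have [_ hx] := height_to_bundle xl.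
have n0 := ellipsoid_sqnorm_gt0 (leaf_coef_domain xl); have n0' := ltW n0.
have nn : Num.sqrt (ellipsoid_sqnorm (x.2 0 2)) ^+ 2 = ellipsoid_sqnorm (x.2 0 2).
  by rewrite sqr_sqrtr.
have n_neq0' : ellipsoid_sqnorm (x.2 0 2) != 0 by rewrite gt_eqF.
have n_neq0 : Num.sqrt (ellipsoid_sqnorm (x.2 0 2)) != 0 by rewrite gt_eqF // sqrtr_gt0.
move: c1 c2 Hx; rewrite /hamiltonian /casimir1 /casimir2 /= => c1 c2; rewrite c1 c2.
move: c1 c2; rewrite !dot3E => c1 c2 Hx.
have R12 : x.2 0 0 * x.2 0 0 + x.2 0 1 * x.2 0 1 = a - x.2 0 2 * x.2 0 2 by lra.
have nE : x.2 0 0 * x.2 0 0 + x.2 0 1 * x.2 0 1 + beta * (x.2 0 2 * x.2 0 2) = ellipsoid_sqnorm (x.2 0 2).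
  by rewrite R12 /ellipsoid_sqnorm; ring.
split=> //.
- rewrite dot3E /to_bundle /= !vecE /=.
  rewrite [LHS](_ : _ = (x.2 0 0 * x.2 0 0 + x.2 0 1 * x.2 0 1 + s ^+ 2 * (x.2 0 2 * x.2 0 2))
    / Num.sqrt (ellipsoid_sqnorm (x.2 0 2)) ^+ 2); last by field.
  by rewrite -ss nE nn divff.
- rewrite dot3E /to_bundle /= !vecE /=.
  rewrite [LHS](_ : _ = (x.1 0 0 * x.2 0 0 + x.1 0 1 * x.2 0 1 + x.1 0 2 * x.2 0 2
     + beta * g3 (a, x.2 0 2) * x.2 0 2
     - shifted_momentum (x.2 0 2) / ellipsoid_sqnorm (x.2 0 2) *
       (x.2 0 0 * x.2 0 0 + x.2 0 1 * x.2 0 1 + s ^+ 2 * (x.2 0 2 * x.2 0 2)))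
    / Num.sqrt (ellipsoid_sqnorm (x.2 0 2))); last by field; rewrite n_neq0 s0 n_neq0'.
  rewrite -ss nE c2 divfK // /shifted_momentum; by field.
rewrite /fiber_sqradius hx dot3E /to_bundle /= !vecE /= /effective_potential.
have TN : (x.1 0 0 + g1 (a, x.2 0 2) * x.2 0 1) * x.2 0 0 +
   (x.1 0 1 - g1 (a, x.2 0 2) * x.2 0 0) * x.2 0 1 + (x.1 0 2 + beta * g3 (a, x.2 0 2)) * x.2 0 2
   = shifted_momentum (x.2 0 2).
  by rewrite /shifted_momentum -c2; ring.
rewrite -Hx; move: (shifted_momentum _) TN => G TN.
(* The expansion [|T - c N|^2 = |T|^2 - 2 c <T, N> + c^2 |N|^2], with [c = G / |N|^2]. *)
rewrite [LHS](_ : _ = (x.1 0 0 + g1 (a, x.2 0 2) * x.2 0 1) ^+ 2 +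
   (x.1 0 1 - g1 (a, x.2 0 2) * x.2 0 0) ^+ 2 + (x.1 0 2 + beta * g3 (a, x.2 0 2)) ^+ 2 / s ^+ 2
   - 2 * (G / ellipsoid_sqnorm (x.2 0 2)) * ((x.1 0 0 + g1 (a, x.2 0 2) * x.2 0 1) * x.2 0 0 +
   (x.1 0 1 - g1 (a, x.2 0 2) * x.2 0 0) * x.2 0 1 + (x.1 0 2 + beta * g3 (a, x.2 0 2)) * x.2 0 2)
   + (G / ellipsoid_sqnorm (x.2 0 2)) ^+ 2 * (x.2 0 0 * x.2 0 0 + x.2 0 1 * x.2 0 1 + s ^+ 2 * (x.2 0 2 * x.2 0 2))); last first.
  by field; rewrite s0 n_neq0'.
rewrite -ss TN nE.
have b0 : beta != 0 by rewrite gt_eqF.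
have -> : a - x.2 0 2 ^+ 2 = x.2 0 0 * x.2 0 0 + x.2 0 1 * x.2 0 1 by rewrite R12 expr2.
move: (ellipsoid_sqnorm _) n_neq0' => n n_neq0''; field.
by rewrite b0 n_neq0''.
Qed.


Lemma of_bundle_facts y : bundle fiber_sqradius setT y ->
  let w := Num.sqrt (height_weight (y.2 0 2)) in
  let z := height (y.2 0 2) in
  [/\ w != 0, w ^+ 2 = beta * (y.2 0 0 * y.2 0 0 + y.2 0 1 * y.2 0 1) + y.2 0 2 * y.2 0 2,
      ellipsoid_sqnorm z = (A * s / w) ^+ 2, Num.sqrt (ellipsoid_sqnorm z) = A * s / w
    & (A * s * y.2 0 0 / w) * (A * s * y.2 0 0 / w) + (A * s * y.2 0 1 / w) * (A * s * y.2 0 1 / w)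
      = a - z * z].
Proof.
move=> yb; have w0 := height_weight_gt0 (bundle_unit_segment yb); have w0' := ltW w0.
have [rr tr tt _] := yb; rewrite !dot3E in rr tr tt.
rewrite /=; set w := Num.sqrt _; set z := height _.
have ww : w ^+ 2 = height_weight (y.2 0 2) by rewrite sqr_sqrtr.
have w_neq0 : w != 0 by rewrite gt_eqF // sqrtr_gt0.
have w2_neq0 : w ^+ 2 != 0 by rewrite expf_neq0.
have E12 : y.2 0 0 * y.2 0 0 + y.2 0 1 * y.2 0 1 = 1 - y.2 0 2 * y.2 0 2 by lra.
have nE : ellipsoid_sqnorm z = (A * s / w) ^+ 2.
  apply: (mulIf w2_neq0); rewrite /ellipsoid_sqnorm /z /height -/w -/A.
  rewrite [RHS](_ : _ = A ^+ 2 * s ^+ 2); last by field.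
  rewrite [LHS](_ : _ = a * w ^+ 2 + (beta - 1) * A ^+ 2 * y.2 0 2 ^+ 2); last by field.
  by rewrite -AA -ss ww /height_weight; ring.
split=> //.
- by rewrite ww E12 /height_weight; ring.
- by rewrite nE sqrtr_sqr ger0_norm // divr_ge0 ?mulr_ge0 ?sqrtr_ge0.
rewrite [LHS](_ : _ = A ^+ 2 * s ^+ 2 * (y.2 0 0 * y.2 0 0 + y.2 0 1 * y.2 0 1) / w ^+ 2); last by field.
apply: (mulIf w2_neq0); rewrite divfK // E12 /z /height -/w -/A.
rewrite [RHS](_ : _ = a * w ^+ 2 - A ^+ 2 * (y.2 0 2 * y.2 0 2)); last by field.
by rewrite ww -AA -ss /height_weight; ring.
Qed.

Lemma of_bundleP y : bundle fiber_sqradius setT y -> level a g H h (of_bundle y).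
Proof.
move=> yb; have := of_bundle_facts yb; rewrite /=.
have [rr tr tt _] := yb; rewrite !dot3E in rr tr tt.
have zE : height (y.2 0 2) = A * y.2 0 2 / Num.sqrt (height_weight (y.2 0 2)) by [].
case=> w0 wE nE _ R12.
have c1 : casimir1 (of_bundle y) = a.
  by rewrite /casimir1 dot3E /of_bundle /= !vecE /= R12; ring.
have c2 : casimir2 (of_bundle y) = g.
  rewrite /casimir2 dot3E /of_bundle /= !vecE /=.
  move: wE zE {nE R12 c1}; move: (Num.sqrt _) w0 (height _) => w w0 z wE zE.
  have GE : shifted_momentum z = g + beta * g3 (a, z) * z by [].
  move: (shifted_momentum z) (g1 (a, z)) (g3 (a, z)) GE => G k1 k3 GE.
  rewrite [LHS](_ : _ = A * s / w * (y.1 0 0 * y.2 0 0 + y.1 0 1 * y.2 0 1 + y.1 0 2 * y.2 0 2)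
    + G * (y.2 0 0 * y.2 0 0 + y.2 0 1 * y.2 0 1 + y.2 0 2 * y.2 0 2) - beta * k3 * z).
    by rewrite tr rr GE; ring.
  by rewrite zE; field; rewrite w0 A0 s0.
split; first by split.
rewrite /= /hamiltonian -/(casimir1 _) -/(casimir2 _) c1 c2.
rewrite /of_bundle /= !vecE /=.
have hE : h = fiber_sqradius (y.2 0 2) / 2 + effective_potential (height (y.2 0 2)).
  by rewrite /fiber_sqradius; field.
rewrite [RHS]hE -tt /effective_potential nE.
have -> : a - height (y.2 0 2) ^+ 2 = (A * s * y.2 0 0 / Num.sqrt (height_weight (y.2 0 2))) ^+ 2
   + (A * s * y.2 0 1 / Num.sqrt (height_weight (y.2 0 2))) ^+ 2.
  by rewrite expr2 -R12 !expr2.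
move: (shifted_momentum _) (g1 _) (g2 _) (g3 _) (V _) => G k1 k2 k3 k4.
move: (Num.sqrt _) w0 => w w0.
apply/eqP; rewrite -subr_eq0 ss; apply/eqP.
(* The difference of the two energies is a combination of [<tau, r>] and [<r, r> - 1], both zero on
   the bundle. *)
rewrite [LHS](_ : _ = G * w / (A * s) * (y.1 0 0 * y.2 0 0 + y.1 0 1 * y.2 0 1 + y.1 0 2 * y.2 0 2)
  + (G * w / (A * s)) ^+ 2 * ((y.2 0 0 * y.2 0 0 + y.2 0 1 * y.2 0 1 + y.2 0 2 * y.2 0 2) - 1) / 2).
  by rewrite tr rr; ring.
by field; rewrite ?w0 ?A0 ?s0.
Qed.

Lemma of_bundleK y : bundle fiber_sqradius setT y -> to_bundle (of_bundle y) = y.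
Proof.
move=> yb.
have [/= w0 wE nE nE' R12] := of_bundle_facts yb.
have [rr tr tt _] := yb; rewrite !dot3E in rr tr tt.
rewrite /to_bundle.
have -> : (of_bundle y).2 0 2 = height (y.2 0 2) by rewrite /of_bundle /= vecE.
rewrite nE' nE [RHS]surjective_pairing [y.1 in RHS]vec3_eta [y.2 in RHS]vec3_eta.
have zE : height (y.2 0 2) = A * y.2 0 2 / Num.sqrt (height_weight (y.2 0 2)) by [].
rewrite /of_bundle /= !vecE /=.
move: (shifted_momentum _) (g1 _) (g3 _) => G k1 k3.
move: (height _) zE => _ ->; move: (Num.sqrt _) w0 => w w0.
by congr (vec _ [:: _; _; _], vec _ [:: _; _; _]); field; rewrite ?A0 ?s0 ?w0.
Qed.

Lemma level_bundle : diffeomorphic (level a g H h) (bundle fiber_sqradius setT).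
Proof.
exists to_bundle, of_bundle; split.
- exact: to_bundleP.
- exact: of_bundleP.
- split=> [x xl|y yb].
    have [wE hE] := height_to_bundle xl.1.
    have n0 := ellipsoid_sqnorm_gt0 (leaf_coef_domain xl.1); have n0' := ltW n0.
    have nn : Num.sqrt (ellipsoid_sqnorm (x.2 0 2)) ^+ 2 = ellipsoid_sqnorm (x.2 0 2).
      by rewrite sqr_sqrtr.
    have n_neq0 : Num.sqrt (ellipsoid_sqnorm (x.2 0 2)) != 0 by rewrite gt_eqF // sqrtr_gt0.
    rewrite /of_bundle wE hE [RHS]surjective_pairing [x.1 in RHS]vec3_eta [x.2 in RHS]vec3_eta.
    rewrite /to_bundle /= !vecE /=.
    move: nn n_neq0; move: (Num.sqrt _) => n <- n_neq0.
    by congr (vec _ [:: _; _; _], vec _ [:: _; _; _]); field; rewrite ?A0 ?s0 ?n_neq0.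
  exact: of_bundleK.
- have lc x : level a g H h x -> coef_domain (a, x.2 0 2) by move=> [/leaf_coef_domain].
  have sk (k : R * R -> R) : smooth_on (@coef_domain R) k ->
      smooth_on (level a g H h) (fun x => k (a, x.2 0 2)).
    by move=> sk; apply: (@smooth_on_comp _ _ _ _ _ _ _ _
      (fun x : 'rV[R]_3 * 'rV[R]_3 => (a, x.2 0 2)) k lc sk); smooth.
  have sn : smooth_on (level a g H h) (fun x => ellipsoid_sqnorm (x.2 0 2)).
    by rewrite /ellipsoid_sqnorm; smooth.
  have sc : smooth_on (level a g H h)
      (fun x => shifted_momentum (x.2 0 2) / ellipsoid_sqnorm (x.2 0 2)).
    rewrite /shifted_momentum; apply: smooth_onM; first by smooth; exact: sk.
    apply: smooth_onV => // x /lc/ellipsoid_sqnorm_gt0 x0; by rewrite gt_eqF.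
  have n0 x : level a g H h x -> Num.sqrt (ellipsoid_sqnorm (x.2 0 2)) != 0.
    by move=> /lc/ellipsoid_sqnorm_gt0 x0; rewrite gt_eqF // sqrtr_gt0.
  rewrite /to_bundle; smooth => //; try exact: sk.
1-3: by move=> x /lc/ellipsoid_sqnorm_gt0 x0; rewrite gt_eqF.
  1-3: by move=> x /lc/ellipsoid_sqnorm_gt0.
- have lu y : bundle fiber_sqradius setT y -> unit_segment (y.2 0 2).
    exact: bundle_unit_segment.
  have sk (k : R -> R) : smooth_on unit_segment k ->
      smooth_on (bundle fiber_sqradius setT) (fun y => k (y.2 0 2)).
    by move=> sk; apply: (@smooth_on_comp _ _ _ _ _ _ _ _
      (fun x : 'rV[R]_3 * 'rV[R]_3 => x.2 0 2) k lu sk); smooth.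
  have sm (k : R * R -> R) : smooth_on (@coef_domain R) k ->
      smooth_on unit_segment (fun t => k (a, height t)).
    move=> sk'; apply: (@smooth_on_comp _ _ _ _ _ _ _ _ (fun t => (a, height t)) k
      height_coef_domain sk').
    by apply: smooth_on_pair; [exact: smooth_on_cst|exact: smooth_on_height].
  have sM : smooth_on unit_segment (fun t => shifted_momentum (height t)).
    rewrite /shifted_momentum; apply: smooth_onD; first exact: smooth_on_cst.
    apply: smooth_onM; last exact: smooth_on_height.
    by apply: smooth_onM; [exact: smooth_on_cst|exact: sm].
  have h1 := sk _ smooth_on_height; have h2 := sk _ (sm _ sg1).
  have h3 := sk _ (sm _ sg3); have h4 := sk _ sM.
  have h5 : smooth_on (bundle fiber_sqradius setT)
      (fun y => Num.sqrt (height_weight (y.2 0 2))).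
    rewrite /height_weight; smooth => y /lu; exact: height_weight_gt0.
  have w0 y : bundle fiber_sqradius setT y -> Num.sqrt (height_weight (y.2 0 2)) != 0.
    by move=> /lu/height_weight_gt0 w0; rewrite gt_eqF // sqrtr_gt0.
  rewrite /of_bundle; repeat first [exact: h1 | exact: h2 | exact: h3 | exact: h4 | exact: h5 | smooth_step].
  all: by move=> // *; rewrite ?w0 // mulf_neq0.
Qed.

End Reduction.

Lemma smooth_on_differentiable (R : realType) (V W : normedModType R) (A : set V) (k : V -> W) x :
  open A -> A x -> smooth_on A k -> differentiable k x.
Proof.
move=> oA Ax sk; have [U [F [Ux oU CF EF]]] := smooth_on_elim sk Ax.
apply: near_eq_differentiable (Ck_differentiable (CF 0%N) Ux).
have : nbhs x (U `&` A) by apply: filterI; exact: open_nbhs_nbhs.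
by apply: filterS => y [Uy Ay]; exact: EF.
Qed.

(** * Regular energy levels have simple zeros *)

Section Regularity.
Context {R : realType} (a g beta : R) (g1 g2 g3 V : R * R -> R) (h : R).
Context (a_gt0 : 0 < a) (beta_gt0 : 0 < beta).
Context (sg1 : smooth_on (@coef_domain R) g1) (sg2 : smooth_on (@coef_domain R) g2)
  (sg3 : smooth_on (@coef_domain R) g3) (sV : smooth_on (@coef_domain R) V).

Let s := Num.sqrt beta.
Let s0 : s != 0. Proof. by rewrite gt_eqF // sqrtr_gt0. Qed.
Let ss : beta = s ^+ 2. Proof. by rewrite sqr_sqrtr // ltW. Qed.
Local Notation H := (hamiltonian beta g1 g2 g3 V).
Local Notation f := (fiber_sqradius a g beta g1 g2 g3 V h).
Local Notation E3 := ('rV[R]_3 * 'rV[R]_3)%type.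

(** The differential of [H] is taken in the ambient space, so the completion of squares is needed on
    an open set and not on the leaf alone. *)
Definition punctured : set E3 := [set x | 0 < dot x.2 x.2].

Definition moment_coords (x : E3) : R * R * R := (dot x.2 x.2, x.2 0 2, dot x.1 x.2).

Definition potential_domain : set (R * R * R) := [set p | coef_domain p.1].

(** The effective potential with the values of both Casimirs left variable; at [(a, z, g)] it is
    [effective_potential] at [z]. *)
Definition full_potential (p : R * R * R) : R :=
  g2 p.1 * p.2 + V p.1 - g1 p.1 ^+ 2 * (p.1.1 - p.1.2 ^+ 2) / 2
  - beta * g3 p.1 ^+ 2 / 2
  + (p.2 + beta * g3 p.1 * p.1.2) ^+ 2 / (2 * (p.1.1 - p.1.2 ^+ 2 + beta * p.1.2 ^+ 2)).

(** The coordinates of the part of [T] orthogonal to [N], extended off the leaf. Beyond index 2 the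
    value is the default 0, so statements over all [i] stay correct. *)
Definition fiber_coord (i : nat) (x : E3) : R :=
  let p := (dot x.2 x.2, x.2 0 2) in
  let c := (dot x.1 x.2 + beta * g3 p * x.2 0 2)
           / (dot x.2 x.2 - x.2 0 2 ^+ 2 + beta * x.2 0 2 ^+ 2) in
  [:: x.1 0 0 + g1 p * x.2 0 1 - c * x.2 0 0;
      x.1 0 1 - g1 p * x.2 0 0 - c * x.2 0 1;
      (x.1 0 2 + beta * g3 p) / s - c * s * x.2 0 2]`_i.

Lemma weighted_gt0 (p : R * R) : coef_domain p -> 0 < p.1 - p.2 ^+ 2 + beta * p.2 ^+ 2.
Proof. by case: p => u z [u0 zu]; exact: (ellipsoid_sqnorm_gt0 u0 beta_gt0 (conj u0 zu)). Qed.

Lemma punctured_coef x : punctured x -> coef_domain (dot x.2 x.2, x.2 0 2).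
Proof.
move=> x0; split=> //=; rewrite dot3E.
have := sqr_ge0 (x.2 0 0); have := sqr_ge0 (x.2 0 1); rewrite !expr2; lra.
Qed.

Lemma hamiltonian_split x : punctured x ->
  H x = (fiber_coord 0 x * fiber_coord 0 x + fiber_coord 1 x * fiber_coord 1 x
    + fiber_coord 2 x * fiber_coord 2 x) / 2 + full_potential (moment_coords x).
Proof.
move=> xp; have /= := weighted_gt0 (punctured_coef xp) => n0.
rewrite /fiber_coord /full_potential /moment_coords /hamiltonian /=.
have n_neq0 : dot x.2 x.2 - x.2 0 2 ^+ 2 + beta * x.2 0 2 ^+ 2 != 0 by rewrite gt_eqF.
move: (g1 _) (g2 _) (g3 _) (V _) => k1 k2 k3 k4.
rewrite ss in n_neq0 *; move: n_neq0; rewrite !dot3E => n_neq0.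
have E : x.2 0 0 * x.2 0 0 + x.2 0 1 * x.2 0 1 + x.2 0 2 * x.2 0 2 - x.2 0 2 ^+ 2
   + s ^+ 2 * x.2 0 2 ^+ 2 = x.2 0 0 * x.2 0 0 + x.2 0 1 * x.2 0 1 + s ^+ 2 * (x.2 0 2 * x.2 0 2).
  by ring.
rewrite E in n_neq0 *.
by field; rewrite n_neq0 s0.
Qed.

Lemma smooth_on_full_potential : smooth_on potential_domain full_potential.
Proof.
have sk (k : R * R -> R) : smooth_on (@coef_domain R) k ->
    smooth_on potential_domain (fun p => k p.1).
  by move=> sk; apply: (@smooth_on_comp _ _ _ _ _ _ _ _ (fun p : R * R * R => p.1) k _ sk) => //; smooth.
rewrite /full_potential; smooth; try exact: sk.
by move=> p /weighted_gt0 p0; rewrite mulf_neq0 // gt_eqF.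
Qed.

Lemma smooth_on_fiber_coord i : smooth_on punctured (fiber_coord i).
Proof.
have sk (k : R * R -> R) : smooth_on (@coef_domain R) k ->
    smooth_on punctured (fun x => k (dot x.2 x.2, x.2 0 2)).
  by move=> sk; apply: (@smooth_on_comp _ _ _ _ _ _ _ _
    (fun x : E3 => (dot x.2 x.2, x.2 0 2)) k punctured_coef sk) => //; smooth.
have h1 := sk _ sg1; have h3 := sk _ sg3.
rewrite /fiber_coord; move: i => [|[|[|i]]] /=;
  repeat first [exact: h1 | exact: h3 | smooth_step].
all: try by move=> x /punctured_coef/weighted_gt0 /= x0; rewrite gt_eqF.
Qed.

Lemma open_punctured : open punctured.
Proof.
have sd : smooth_on [set: E3] (fun x => dot x.2 x.2) by smooth.
have [U oU HU] := smooth_on_preimage_open sd (@open_gt R 0).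
rewrite (_ : punctured = U) //; apply/seteqP; split=> x; first by move=> x0; apply/HU.
by move=> /HU; apply.
Qed.


Lemma moment_coords_domain x : punctured x -> potential_domain (moment_coords x).
Proof. exact: punctured_coef. Qed.

Lemma derive_moment_coords x v : leaf_tangent x v ->
  differentiable moment_coords x /\ 'd moment_coords x v = (0, v.2 0 2, 0).
Proof.
move=> [d1 d2].
have dif (k : E3 -> R) : smooth_on [set: E3] k -> differentiable k x.
  by apply: smooth_on_differentiable => //; exact: openT.
have D1 : differentiable (@casimir1 R) x by apply: dif; rewrite /casimir1; smooth.
have D2 : differentiable (@casimir2 R) x by apply: dif; rewrite /casimir2; smooth.
have @cc : {linear E3 -> R}.
  by exists (fun y : E3 => y.2 0 2); do 2![eexists]; do ?[constructor];
     rewrite ?mxE// => ? *; rewrite ?mxE//; move=> ?; rewrite !mxE.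
have ch : continuous cc.
  move=> y; apply: (@continuous_comp _ _ _ (@snd _ _) (fun v : 'rV[R]_3 => v 0 2)).
    exact: snd_continuous.
  exact: coord_continuous.
have D3 : differentiable cc x by exact: linear_differentiable.
have D13 := differentiable_pair D1 D3.
split; first exact: (differentiable_pair D13 D2).
rewrite [LHS](_ : _ = 'd (fun y => ((@casimir1 R y, cc y), @casimir2 R y)) x v) //.
rewrite (diff_pair D13 D2) (diff_pair D1 D3) /= d1 d2.
by rewrite (diff_lin _ ch).
Qed.

(* Where the fiber degenerates, the quadratic part of [H] in the split form
   vanishes to second order, so only the potential contributes to ['d H]. *)
Lemma derive_hamiltonian x v : punctured x -> leaf_tangent x v ->
  (forall i, fiber_coord i x = 0) ->
  exists (U : set (R * R * R)) (F : R * R * R -> R),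
    [/\ open U, U (moment_coords x), forall n, Ck n U F,
      (forall p, U p -> potential_domain p -> F p = full_potential p)
      & 'd H x v = 'd F (moment_coords x) (0, v.2 0 2, 0)].
Proof.
move=> xp xv fx.
have [dq dqv] := derive_moment_coords xv.
(* The domain of the potential has a boundary where [R_3^2 = R^2], that is over the poles; the
   extension [F] has a differential there too. *)
have [U [F [Ux oU CF EF]]] := smooth_on_elim smooth_on_full_potential (moment_coords_domain xp).
exists U, F; split=> //.
have dF := Ck_differentiable (CF 0%N) Ux.
have df i : differentiable (fiber_coord i) x.
  by apply: smooth_on_differentiable (smooth_on_fiber_coord i) => //; exact: open_punctured.
have dFq : differentiable (F \o moment_coords) x by exact: differentiable_comp.
have dff i : is_derive x v (fun y => fiber_coord i y * fiber_coord i y) 0.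
  have dfi : derivable (fiber_coord i) x v by exact: diff_derivable.
  split; first exact: (@derivableM _ _ (fiber_coord i) (fiber_coord i)).
  by rewrite (@deriveM _ _ (fiber_coord i) (fiber_coord i)) // fx !scale0r addr0.
have dG : is_derive x v (F \o moment_coords) ('d F (moment_coords x) (0, v.2 0 2, 0)).
  split; first exact: diff_derivable.
  by rewrite deriveE // diff_comp //= dqv.
have dT : is_derive x v (fun y => (fiber_coord 0 y * fiber_coord 0 y
    + fiber_coord 1 y * fiber_coord 1 y + fiber_coord 2 y * fiber_coord 2 y) * 2^-1
    + F (moment_coords y)) ('d F (moment_coords x) (0, v.2 0 2, 0)).
  have dS := is_deriveD (is_deriveD (dff 0%N) (dff 1%N)) (dff 2%N).
  have := is_deriveD (is_deriveM dS (is_derive_cst (2^-1 : R) x v)) dG.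
  by rewrite !addr0 !scaler0 !add0r.
have nE : \forall y \near x, (fiber_coord 0 y * fiber_coord 0 y
    + fiber_coord 1 y * fiber_coord 1 y + fiber_coord 2 y * fiber_coord 2 y) * 2^-1
    + F (moment_coords y) = H y.
  have cq : {for x, continuous moment_coords} by exact: differentiable_continuous.
  have : nbhs x (punctured `&` moment_coords @^-1` U).
    apply: filterI; first by apply: open_nbhs_nbhs; split=> //; exact: open_punctured.
    by apply: cq; exact: open_nbhs_nbhs.
  apply: filterS => y [yp Uy]; rewrite hamiltonian_split // EF //.
  exact: moment_coords_domain.
have dH : is_derive x v H ('d F (moment_coords x) (0, v.2 0 2, 0)).
  exact: near_eq_is_derive nE dT.
have dd i : differentiable (fun y => fiber_coord i y * fiber_coord i y) x.
  by apply: (@differentiableM _ _ (fiber_coord i) (fiber_coord i)).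
(* Derivability along [v] alone does not identify ['d H x v]; [deriveE] asks for differentiability
   of [H] at [x]. *)
have dHx : differentiable H x.
  apply: near_eq_differentiable nE _.
  have dS := differentiableD (differentiableD (dd 0%N) (dd 1%N)) (dd 2%N).
  exact: (differentiableD (differentiableM dS (differentiable_cst (2^-1 : R) x)) dFq).
by rewrite -deriveE //; have [_ ->] := dH.
Qed.

Lemma derive_casimir1 x v : 'd (@casimir1 R) x v = 2 * dot x.2 v.2.
Proof.
have dc j : is_derive x v (fun y : E3 => y.2 0 j) (v.2 0 j).
  have @cc : {linear E3 -> R}.
    by exists (fun y : E3 => y.2 0 j); do 2![eexists]; do ?[constructor];
       rewrite ?mxE// => ? *; rewrite ?mxE//; move=> ?; rewrite !mxE.
  have ch : continuous cc.
    move=> y; apply: (@continuous_comp _ _ _ (@snd _ _) (fun v : 'rV[R]_3 => v 0 j)).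
      exact: snd_continuous.
    exact: coord_continuous.
  have D3 : differentiable cc x by exact: linear_differentiable.
  by split; [exact: (diff_derivable D3)|rewrite (deriveE _ D3) (diff_lin _ ch)].
have D1 : differentiable (@casimir1 R) x.
  apply: (@smooth_on_differentiable _ _ _ [set: E3]) => //; first exact: openT.
  by rewrite /casimir1; smooth.
rewrite -deriveE //.
have := is_deriveD (is_deriveD (is_deriveM (dc 0) (dc 0)) (is_deriveM (dc 1) (dc 1)))
  (is_deriveM (dc 2) (dc 2)).
have -> : (fun y : E3 => y.2 0 0) * (fun y : E3 => y.2 0 0) + (fun y : E3 => y.2 0 1) * (fun y : E3 => y.2 0 1)
  + (fun y : E3 => y.2 0 2) * (fun y : E3 => y.2 0 2) = @casimir1 R.
  by apply/funext => y; rewrite /casimir1 dot3E.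
by case=> _ ->; rewrite dot3E /GRing.scale /=; ring.
Qed.

Lemma height_inverse z : coef_domain (a, z) ->
  let t := s * z / Num.sqrt (ellipsoid_sqnorm a beta z) in
  unit_segment t /\ height a beta t = z.
Proof.
move=> za t; have [_ za2] := za; rewrite /= in za2.
(* An auxiliary point of the leaf over the height [z], with [S = (g / a) R] so that [<S, R> = g]; it
   brings the statement back to [height_to_bundle]. *)
pose r : 'rV[R]_3 := vec 3 [:: Num.sqrt (a - z ^+ 2); 0; z].
pose x : E3 := (vec 3 [:: g / a * Num.sqrt (a - z ^+ 2); 0; g / a * z], r).
have az0 : 0 <= a - z ^+ 2 by rewrite subr_ge0.
have rr : Num.sqrt (a - z ^+ 2) * Num.sqrt (a - z ^+ 2) + z * z = a.
  by rewrite -!expr2 sqr_sqrtr // subrK.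
have a0 : a != 0 by rewrite gt_eqF.
have xl : leaf a g x.
  split; rewrite /casimir1 /casimir2 dot3E /= !vecE /= ?mulr0 ?addr0 //.
  rewrite [LHS](_ : _ = g / a * (Num.sqrt (a - z ^+ 2) * Num.sqrt (a - z ^+ 2) + z * z)); last by ring.
  by rewrite rr divfK.
have [_] := height_to_bundle g1 g3 a_gt0 beta_gt0 xl.
rewrite /to_bundle /= !vecE /= -/s -/t => ht; split=> //.
have n0 := ellipsoid_sqnorm_gt0 a_gt0 beta_gt0 za.
have t2 : t ^+ 2 <= 1.
  rewrite /t exprMn exprVn exprMn -ss sqr_sqrtr ?(ltW n0) // ler_pdivrMr // mul1r.
  by rewrite /ellipsoid_sqnorm lerDr.
by apply/andP; split; nra.
Qed.

(** Over a zero [c] of [f] the fiber is a single point [x], at which the differential of [H] on the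
    leaf is the derivative of the potential in [R_3] times the change of [R_3]. Regularity makes
    both factors nonzero for some tangent vector: the second excludes the poles, the first excludes
    a critical point of [f]. *)
Lemma isoenergy_simple_zeros :
  (forall x, level a g H h x -> exists2 v, leaf_tangent x v & 'd H x v != 0) ->
  simple_zeros f.
Proof.
move=> reg c c1 fc.
pose r : 'rV[R]_3 := vec 3 [:: Num.sqrt (1 - c ^+ 2); 0; c].
have c2 : 0 <= 1 - c ^+ 2 by move: c1 => /andP[]; nra.
have rr : dot r r = 1.
  by rewrite dot3E !vecE /= mulr0 addr0 -!expr2 sqr_sqrtr // subrK.
pose y : E3 := (0, r).
have yb : bundle f setT y.
  by split=> //=; rewrite dot3E !mxE ?mul0r ?addr0 //= fc.
pose x := of_bundle a g beta g1 g3 y.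
have xl : level a g H h x by exact: of_bundleP.
have [[x1 x2] _] := xl; rewrite /casimir1 /casimir2 in x1 x2.
have xp : punctured x by rewrite /punctured /= x1.
have xy : to_bundle a g beta g1 g3 x = y.
  exact: (of_bundleK a_gt0 beta_gt0 yb).
have fx i : fiber_coord i x = 0.
  have tx (j : 'I_3) : (to_bundle a g beta g1 g3 x).1 0 j = 0 by rewrite xy mxE.
  rewrite /fiber_coord x1 x2; move: i => [|[|[|i]]] /=; last by rewrite nth_nil.
  - by have := tx 0; rewrite /to_bundle /= vecE.
  - by have := tx 1; rewrite /to_bundle /= vecE.
  - by have := tx 2; rewrite /to_bundle /= vecE.
have zx : x.2 0 2 = height a beta c by rewrite /x /of_bundle /= vecE /= vecE.
have [v xv dv] := reg x xl.
have [U [F [oU Ux CF EF dHF]]] := derive_hamiltonian xp xv fx.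
have dF := Ck_differentiable (CF 0%N) Ux.
have w0 : 0 < height_weight beta c by exact: height_weight_gt0.
have v3 : v.2 0 2 != 0.
  apply: contraNneq dv => v0; rewrite dHF v0.
  have -> : ((0 : R, 0 : R), 0 : R) = 0 by [].
  by rewrite linear0.
have lin0 : 'd F (moment_coords x) (0, 1, 0) != 0.
  apply: contraNneq dv => F0; rewrite dHF.
  have -> : (0 : R, v.2 0 2 : R, 0 : R) = v.2 0 2 *: ((0, 1), 0).
    by congr (_, _, _); rewrite /GRing.scale /= ?mulr0 ?mulr1.
  by rewrite linearZ F0 /= scaler0.
(* At a pole [R] is vertical, so [<R, v> = 0] for the [R] part of a tangent vector forces its third
   component to vanish. *)
have cpole : c ^+ 2 != 1.
  apply: contra_neq v3 => cc.
  have [+ _] := xv; rewrite derive_casimir1 dot3E zx.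
  rewrite /x /of_bundle /= /r !vecE /= cc subrr sqrtr0 !(mulr0, mul0r) !add0r => /eqP.
  rewrite !mulf_eq0 pnatr_eq0 /= => /orP[|/eqP //].
  rewrite invr_eq0 !sqrtr_eq0 !leNgt a_gt0 w0 /= orbF => /eqP c0.
  by move: cc; rewrite c0 expr0n /= => /eqP; rewrite eq_sym oner_eq0.
have [c11 c12] : -1 < c /\ c < 1.
  move: c1 => /andP[h1 h2]; split; rewrite lt_neqAle ?h1 ?h2 andbT.
    by apply: contra_neq cpole => <-; rewrite sqrrN expr1n.
  by apply: contra_neq cpole => ->; rewrite expr1n.
split=> //; apply: contra_neq lin0 => Df.
(* Along this curve the Casimirs are fixed, and the potential equals [h - f / 2] with [f] evaluated
   at the normalised height [t z]; so [f' c = 0] would annihilate its derivative. *)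
pose k (z : R) : R * R * R := (a, z, g).
have kx : moment_coords x = k (x.2 0 2) by rewrite /moment_coords x1 x2.
have dk1 := differentiable_pair (differentiable_cst a (x.2 0 2)) (@ex_diff _ _ _ _ _ _ _ (is_diff_id (x.2 0 2))).
have dk := differentiable_pair dk1 (differentiable_cst g (x.2 0 2)).
have dk_val : 'd k (x.2 0 2) 1 = (0, 1, 0).
  rewrite [LHS](_ : _ = 'd (fun z : R => ((cst a z, id z), cst g z)) (x.2 0 2) 1) //.
  by rewrite (diff_pair dk1 (differentiable_cst g _)) (diff_pair (differentiable_cst a _) (@ex_diff _ _ _ _ _ _ _ (is_diff_id (x.2 0 2)))) /= !diff_cst diff_val.
rewrite kx -dk_val.
rewrite kx in dF Ux.
rewrite -[LHS]/(('d F (k (x.2 0 2)) \o 'd k (x.2 0 2)) 1) -diff_comp //.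
rewrite -deriveE; last exact: differentiable_comp.
pose t (z : R) := s * z / Num.sqrt (ellipsoid_sqnorm a beta z).
have tz : t (x.2 0 2) = c.
  have : (to_bundle a g beta g1 g3 x).2 0 2 = c by rewrite xy /= vecE.
  by rewrite /to_bundle /= vecE.
(* Strictly between the poles the admissible heights form an open set, on which the derivative in
   [z] of the last identity may be taken. *)
have odom : open [set z : R | z ^+ 2 < a].
  have sq2 : smooth_on [set: R] (fun z : R => z ^+ 2) by smooth.
  have [W oW HW] := smooth_on_preimage_open sq2 (@open_lt R a).
  rewrite (_ : mkset _ = W) //; apply/seteqP; split=> z; first by move=> z0; apply/HW.
  by move=> /HW; apply.
have xdom : x.2 0 2 ^+ 2 < a.
  rewrite zx /height !exprMn exprVn !sqr_sqrtr; [|exact: ltW|exact: ltW].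
  rewrite ltr_pdivrMr // ltr_pM2l // /height_weight ltrDr mulr_gt0 //.
  by rewrite lt_neqAle c2 andbT eq_sym subr_eq0 eq_sym.
have dt : differentiable t (x.2 0 2).
  apply: (smooth_on_differentiable odom xdom); rewrite /t /ellipsoid_sqnorm.
  smooth => z /= za; have n0 : 0 < ellipsoid_sqnorm a beta z by
    apply: ellipsoid_sqnorm_gt0 => //; split=> //=; exact: ltW.
    by rewrite gt_eqF // sqrtr_gt0.
  exact: n0.
have df : differentiable f c.
  apply: (@smooth_on_differentiable _ _ _ unit_segment°).
  - exact: open_interior.
  - exact: interior_unit_segment.
  - by apply: smooth_on_subset (@interior_subset _ _) _; exact: smooth_on_fiber_sqradius.
have dft : is_derive (x.2 0 2) 1 (f \o t) 0.
  rewrite -tz in df Df; split.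
    by apply/derivable1_diffP; exact: differentiable_comp.
  rewrite -derive1E derive1_comp; [|exact/derivable1_diffP|exact/derivable1_diffP].
  by rewrite derive1E Df mul0r.
have dD : is_derive (x.2 0 2) 1 (fun z => h - f (t z) * 2^-1) 0.
  have := is_deriveB_fun (is_derive_cst_fun h _) (is_deriveM_fun dft (is_derive_cst_fun 2^-1 _)).
  by rewrite !mulr0 addr0 subr0.
have nE : \forall z \near x.2 0 2, h - f (t z) * 2^-1 = (F \o k) z.
  have ck : {for x.2 0 2, continuous k} by exact: (differentiable_continuous dk).
  have : nbhs (x.2 0 2) ([set z | z ^+ 2 < a] `&` k @^-1` U).
    apply: filterI; first exact: open_nbhs_nbhs.
    by apply: ck; exact: open_nbhs_nbhs.
  apply: filterS => z [/= za Uz].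
  have zd : coef_domain (a, z) by split=> //=; exact: ltW.
  rewrite /= EF //; have [_ hz] := height_inverse zd.
  rewrite /fiber_sqradius /t hz.
  rewrite [LHS](_ : _ = effective_potential a g beta g1 g2 g3 V z) //; by field.
by have [_ ->] := near_eq_is_derive nE dD.
Qed.
End Regularity.

Theorem theorem8 (R : realType) (a g beta : R) (g1 g2 g3 V : R * R -> R)
    (a_gt0 : 0 < a) (beta_gt0 : 0 < beta)
    (g1_smooth : smooth_on (@coef_domain R) g1)
    (g2_smooth : smooth_on (@coef_domain R) g2)
    (g3_smooth : smooth_on (@coef_domain R) g3)
    (V_smooth : smooth_on (@coef_domain R) V)
    (Q : set (e3dual R))
    (isoQ : isoenergy_surface a g (hamiltonian beta g1 g2 g3 V) Q) :
  diffeomorphic Q (@RP3 R) \/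
  exists k l : nat, (l <= 2)%N /\ disjoint_union_S1xS2_S3 k l Q.
Proof.
have [h [-> _ reg]] := isoQ.
have fs := isoenergy_simple_zeros a_gt0 beta_gt0 g1_smooth g2_smooth g3_smooth V_smooth reg.
have QB := level_bundle g g2 V h a_gt0 beta_gt0 g1_smooth g3_smooth.
have sf := smooth_on_fiber_sqradius g h a_gt0 beta_gt0 g1_smooth g2_smooth g3_smooth V_smooth.
have [BP|[k [l [l2 u]]]] := bundle_classification sf fs.
  by left; exact: (diffeomorphic_trans QB BP).
by right; exists k, l; split=> //; exact: (disjoint_union_diffeomorphic QB u).
Qed.
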